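(* Let $u(t_n)$ be the solution at time $t_n$ of the variable-exponent subdiffusive Black-Scholes problem (P) described in the context, and let $U^n$ be its numerical approximation produced by the time-discrete scheme (D) described in the context, where $\tau=T/N$. Assume that $|q^{(j)}(t)|\le C_q$ for all $t\in[0,T]$, $j=0,1$, for some constant $C_q$ (with $q$ differentiable on $[0,T]$). Then, for $\tau$ sufficiently small, $$\left\|U^N\right\|_A\le C(T)\left(\|\bar c_t\|+\sqrt{\tau\sum_{n=1}^{N}\|F^n\|^2}\right),\qquad \|U^N\|_A:=\sqrt{\tau\sum_{l=1}^N\|U^l\|^2},$$ where $C(T)$ is a positive constant independent of $N$ (equivalently of $\tau$), of $\bar c_t$ and of $f$.
   Context: Parameters: $T>0$, $\sigma>0$, $r\ge 0$, a bounded interval $(\bar a,\bar b)$; $\|\cdot\|$ is the norm of $L^2(\bar a,\bar b)$. The variable exponent satisfies $\alpha\in W^{1,\infty}(0,T)$, $0<\alpha(t)\le\alpha^*<1$ on $[0,T]$, and $\alpha'(0)=0$. Put $\alpha_0=\alpha(0)$, $k(t)=\frac{t^{-\alpha(t)}}{\Gamma(1-\alpha(t))}$, $\beta_{\mu}(t)=\frac{t^{\mu-1}}{\Gamma(\mu)}$, and $(g_1*g_2)(t)=\int_0^t g_1(t-s)g_2(s)\,ds$. Define $$q(t)=(\beta_{\alpha_0}*k)(t)=\int_0^1\frac{(t\varsigma)^{\alpha_0-\alpha(t\varsigma)}}{\Gamma(1-\alpha(t\varsigma))}\,\frac{(1-\varsigma)^{\alpha_0-1}\varsigma^{-\alpha_0}}{\Gamma(\alpha_0)}\,d\varsigma,\qquad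 q(0)=1.$$ Problem (P): $$\partial_t^{\alpha(t)}u-\tfrac12\sigma^2\partial_x^2u-\big(r-\tfrac{\sigma^2}{2}\big)\partial_xu+ru=f(x,t)\ \text{ on }(\bar a,\bar b)\times(0,T),$$ $$u(\bar a,t)=u(\bar b,t)=0,\quad u(x,0)=\bar c_t(x),$$ where $\partial_t^{\alpha(t)}u=k*\partial_tu$. (Here $\bar c_t$ is the name of the initial datum, a function of $x$ only.) Transformed quantities: $\bar c_t^*(x)=\exp\left(-(\frac12-\frac{r}{\sigma^2})x\right)\bar c_t(x)$, $\chi(x,t)=\exp\left(-(\frac12-\frac r{\sigma^2})x\right)f(x,t)$, $\lambda=\frac12\left(\frac\sigma2+\frac r\sigma\right)^2$, and $$F(x,t)=\beta_{\alpha_0}(t)*\Big(\tfrac12\sigma^2\partial_x^2\bar c_t^*(x)-\lambda\bar c_t^*(x)+\chi(x,t)\Big).$$ The data are assumed regular enough that $F(\cdot,t)\in L^2(\bar a,\bar b)$ at the time grid points. Scheme (D): for a positive integer $N$ let $\tau=T/N$, $t_n=n\tau$, $F^n=F(\cdot,t_n)$, and for $1\le j\le n\le N$ $$\varpi_{n,j}=\frac1\tau\int_{t_{n-1}}^{t_n}\int_{t_{j-1}}^{\min(t,t_j)}q'(t-s)\,ds\,dt,\qquad \widetilde\varpi_{n,j}=\frac1\tau\int_{t_{n-1}}^{t_n}\int_{t_{j-1}}^{\min(t,t_j)}\beta_{\alpha_0}(t-s)\,ds\,dt.$$ The functions $\mathcal W^n\in H^2(\bar a,\bar b)\cap H_0^1(\bar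 a,\bar b)$ satisfy $\mathcal W^0=0$ and, for $1\le n\le N$, $$\mathcal W^n+\sum_{j=1}^n\varpi_{n,j}\mathcal W^j+\lambda\sum_{j=1}^n\widetilde\varpi_{n,j}\mathcal W^j-\tfrac12\sigma^2\sum_{j=1}^n\widetilde\varpi_{n,j}\partial_x^2\mathcal W^j=F^n .$$ The numerical approximation of $u(t_n)=u(\cdot,t_n)$ is $U^n=\exp\left((\frac12-\frac r{\sigma^2})x\right)(\mathcal W^n+\bar c_t^* )$. *)

(* Defs.v *)
From HB Require Import structures.
From mathcomp Require Import all_boot all_order all_algebra.
From mathcomp Require Import all_classical all_reals all_analysis.

Set Implicit Arguments.
Unset Strict Implicit.
Unset Printing Implicit Defensive.
Import Order.TTheory GRing.Theory Num.Theory.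
Import numFieldNormedType.Exports.

Local Open Scope classical_set_scope.
Local Open Scope ring_scope.

(** Functions of position are [R -> R], functions of position and time are
    [R -> R -> R] with position first.  Elements of L^p(a, b) are represented by
    functions on the whole line, only their restriction to ]a, b[ matters. *)

(** * Lebesgue and Sobolev spaces on an interval *)

Definition inLp (R : realType) (p : \bar R) (a b : R) (g : R -> R) : Prop :=
  g \_ `]a, b[ \in Lfun (@lebesgue_measure R) p.

Definition L2norm (R : realType) (a b : R) (g : R -> R) : R :=
  fine ('N[@lebesgue_measure R]_(2%:E) [EFin \o g \_ `]a, b[])%E.

(* C_c^oo(a, b) *)
Definition test_function (R : realType) (a b : R) (phi : R -> R) : Prop :=
  [/\ forall (n : nat) (x : R), derivable (derive1n n phi) x 1,
      compact (closure [set x | phi x != 0]) &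
      closure [set x | phi x != 0] `<=` `]a, b[].

(* v is the weak derivative of order m of w on (a, b) *)
Definition weak_derivative (R : realType) (a b : R) (m : nat)
    (w v : R -> R) : Prop :=
  [/\ locally_integrable `]a, b[ w, locally_integrable `]a, b[ v &
      forall phi : R -> R, test_function a b phi ->
        \int[@lebesgue_measure R]_(x in `]a, b[) (w x * derive1n m phi x) =
        (-1) ^+ m * \int[@lebesgue_measure R]_(x in `]a, b[) (v x * phi x)].

(* W^{m,p}(a, b); the case i = 0 says that w itself is in L^p(a, b) *)
Definition sobolev (R : realType) (m : nat) (p : \bar R) (a b : R)
    (w : R -> R) : Prop :=
  forall i : nat, (i <= m)%N ->
    exists v : R -> R, inLp p a b v /\ weak_derivative a b i w v.

(* H^1_0(a, b), the closure of C_c^oo(a, b) in H^1(a, b) *)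
Definition H10 (R : realType) (a b : R) (w : R -> R) : Prop :=
  exists dw : R -> R,
    [/\ inLp 2%:E a b w, inLp 2%:E a b dw, weak_derivative a b 1 w dw &
        exists phi : nat -> R -> R,
          [/\ forall m : nat, test_function a b (phi m),
              (fun m => L2norm a b (phi m \- w)) @ \oo --> (0 : R) &
              (fun m => L2norm a b (derive1 (phi m) \- dw)) @ \oo --> (0 : R)]].

(* derivative of g at t relative to A: one-sided at the ends of an interval *)
Definition has_derivative_within (R : realType) (A : set R) (g : R -> R)
    (t l : R) : Prop :=
  (fun s => (g s - g t) / (s - t)) @ within A t^' --> l.

(** * Kernels *)

Definition Gamma (R : realType) (z : R) : R :=
  \int[@lebesgue_measure R]_(x in `]0, +oo[) (x `^ (z - 1) * expR (- x)).

Definition time_conv (R : realType) (g1 g2 : R -> R) (t : R) : R :=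
  \int[@lebesgue_measure R]_(s in `[0, t]) (g1 (t - s) * g2 s).

Definition beta_kernel (R : realType) (mu t : R) : R :=
  t `^ (mu - 1) / Gamma mu.

Definition k_kernel (R : realType) (alpha : R -> R) (t : R) : R :=
  t `^ (- alpha t) / Gamma (1 - alpha t).

Definition q_kernel (R : realType) (alpha : R -> R) (t : R) : R :=
  if t == 0 then 1 else time_conv (beta_kernel (alpha 0)) (k_kernel alpha) t.

(** * Variable-exponent subdiffusive Black-Scholes problem *)

(* Strong solutions: u(x, .) is in W^{1,1}(0, T) for almost every x (with its
   continuous representative, so that the initial condition is meaningful),
   u(., t) is in H^2(a, b) and H^1_0(a, b) for almost every t, and the equation
   holds almost everywhere.  v, ux, uxx are the weak derivatives of u. *)
Definition bs_solution (R : realType) (T sigma r a b : R) (alpha : R -> R)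
    (f : R -> R -> R) (c : R -> R) (u : R -> R -> R) : Prop :=
  exists v ux uxx : R -> R -> R,
    {ae @lebesgue_measure R, forall x, x \in `]a, b[ ->
      [/\ sobolev 1 1%:E 0 T (u x), weak_derivative 0 T 1 (u x) (v x),
          {within `[0, T], continuous (u x)} & u x 0 = c x]} /\
    {ae @lebesgue_measure R, forall t, t \in `]0, T[ ->
      [/\ sobolev 2 2%:E a b (u^~ t), H10 a b (u^~ t),
          weak_derivative a b 1 (u^~ t) (ux^~ t),
          weak_derivative a b 2 (u^~ t) (uxx^~ t) &
          {ae @lebesgue_measure R, forall x, x \in `]a, b[ ->
            time_conv (k_kernel alpha) (v x) t
              - 2^-1 * sigma ^+ 2 * uxx x t
              - (r - sigma ^+ 2 / 2) * ux x t
              + r * u x t = f x t}]}.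

(** * Transformed data *)

Definition bs_shift (R : realType) (sigma r : R) : R := 2^-1 - r / sigma ^+ 2.

Definition bs_lambda (R : realType) (sigma r : R) : R :=
  2^-1 * (sigma / 2 + r / sigma) ^+ 2.

Definition cstar (R : realType) (sigma r : R) (c : R -> R) (x : R) : R :=
  expR (- (bs_shift sigma r * x)) * c x.

Definition chi (R : realType) (sigma r : R) (f : R -> R -> R) (x t : R) : R :=
  expR (- (bs_shift sigma r * x)) * f x t.

(* d2c stands for the weak second derivative of [cstar sigma r c] *)
Definition bs_F (R : realType) (sigma r alpha0 : R) (c d2c : R -> R)
    (f : R -> R -> R) (x t : R) : R :=
  time_conv (beta_kernel alpha0)
    (fun s => 2^-1 * sigma ^+ 2 * d2c x - bs_lambda sigma r * cstar sigma r c x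
              + chi sigma r f x s) t.

(** * Time-discrete scheme *)

(* varpi_{n,j} is the case g = q', its tilded version the case
   g = beta_{alpha0}; meant for 1 <= j <= n *)
Definition weight (R : realType) (tau : R) (g : R -> R) (n j : nat) : R :=
  tau^-1 *
  \int[@lebesgue_measure R]_(t in `[n.-1%:R * tau, n%:R * tau])
    \int[@lebesgue_measure R]_(s in `[j.-1%:R * tau, Num.min t (j%:R * tau)])
      g (t - s).

Definition bs_scheme (R : realType) (sigma r a b alpha0 : R) (dq : R -> R)
    (tau : R) (N : nat) (F : R -> R -> R) (W : nat -> R -> R) : Prop :=
  [/\ forall n : nat, (n <= N)%N -> sobolev 2 2%:E a b (W n) /\ H10 a b (W n),
      {ae @lebesgue_measure R, forall x, x \in `]a, b[ -> W 0%N x = 0} &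
      exists d2W : nat -> R -> R,
        (forall n : nat, (n <= N)%N -> weak_derivative a b 2 (W n) (d2W n)) /\
        forall n : nat, (1 <= n <= N)%N ->
          {ae @lebesgue_measure R, forall x, x \in `]a, b[ ->
            W n x + \sum_(1 <= j < n.+1) weight tau dq n j * W j x
            + bs_lambda sigma r *
              \sum_(1 <= j < n.+1)
                 weight tau (beta_kernel alpha0) n j * W j x
            - 2^-1 * sigma ^+ 2 *
              \sum_(1 <= j < n.+1)
                 weight tau (beta_kernel alpha0) n j * d2W j x
            = F x (n%:R * tau)}].

Definition bs_approx (R : realType) (sigma r : R) (c : R -> R)
    (W : nat -> R -> R) (n : nat) (x : R) : R :=
  expR (bs_shift sigma r * x) * (W n x + cstar sigma r c x).

Definition normA (R : realType) (a b tau : R) (N : nat)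
    (U : nat -> R -> R) : R :=
  Num.sqrt (tau * \sum_(1 <= l < N.+1) L2norm a b (U l) ^+ 2).

(* Main.v *)
(** Test the n-th equation of the scheme with W^n and add the equations for
    1 <= n <= m.  The weights of the kernel beta form a lower triangular Toeplitz
    matrix whose entries are, up to a positive factor, the second differences of
    |x|^(1 + alpha_0) at the integers, the diagonal one being halved.  These form a
    nonnegative, nonincreasing and convex sequence, so the quadratic form of the
    matrix is nonnegative, and the terms in lambda W and in the second derivative
    (after integration by parts) can be dropped.  The weights of q' are bounded by
    Cq tau, so the memory term is absorbed by Young's inequality and a discrete
    Gronwall lemma.  Finally U^n = exp(k x) W^n + c with k = bs_shift. *)

Require Import Defs.
From HB Require Import structures.
From mathcomp Require Import all_boot all_order all_algebra.
From mathcomp Require Import all_classical all_reals all_analysis.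
From mathcomp Require Import measurable_realfun.
From mathcomp Require Import ring lra.
Import Order.TTheory GRing.Theory Num.Theory.
Import numFieldNormedType.Exports.
Local Open Scope classical_set_scope.
Local Open Scope ring_scope.

(** Three obstacles shape the proof. The kernel beta is singular at 0, and its weights must be known
    exactly, since bounds would not give the sign of a quadratic form; hence an improper version of
    the fundamental theorem of calculus. The signs of the higher differences of a power come from
    iterated mean values, which miss index 0, where the even extension has a kink; there an explicit
    inequality between 2^s and 3^s takes over. Finally, the weak second derivatives in the scheme
    are only locally integrable functions, so none of them can be paired alone with an element of
    H^1_0; only the whole elliptic part of an equation is square integrable, being equal almost
    everywhere to the rest of that equation. The step size is restricted for a single reason: the
    memory sum contains the current level, which Gronwall has to move to the left-hand side. *)

Local Notation mu := lebesgue_measure.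

(** * Convex Toeplitz forms and a discrete Gronwall lemma *)

(** After exchanging the sums, [a i] has the coefficient d N + ... + d (N - i), which telescopes to
    c (N - i) - c (N + 1); the boundary term cancels the constant part. It serves to recover a
    Toeplitz row from the cross terms of squared tail sums. *)
Lemma sum_by_parts (R : realFieldType) (d a : nat -> R) (N : nat) (c : nat -> R) :
  (forall k, d k = c k - c k.+1) ->
  \sum_(0 <= j < N.+1) d (N - j)%N * (\sum_(j <= i < N) a i)
    + c N.+1 * (\sum_(0 <= i < N) a i) = \sum_(0 <= j < N) c (N - j)%N * a j.
Proof.
move=> dE.
have H : forall m, (m <= N)%N ->
    \sum_(0 <= j < m) d (N - j)%N * (\sum_(j <= i < N) a i)
    + c N.+1 * (\sum_(0 <= i < N) a i) =
    \sum_(0 <= j < m) c (N - j)%N * a j + c (N - m).+1 * \sum_(m <= i < N) a i.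
  elim=> [_|m IH mN]; first by rewrite !(big_geq (leqnn 0)) !add0r subn0.
  rewrite !big_nat_recr//= addrAC IH 1?ltnW// dE subnSK//.
  rewrite (@big_ltn _ _ _ m N)//; ring.
rewrite big_nat_recr//= addrAC H// (big_geq (leqnn N)); ring.
Qed.

(** With the diagonal halved, the summand for [n] is exactly half of what row and column [n] add to
    the quadratic form of the symmetric matrix with entries c |i - j|. Half of a sum of squares of
    tail sums of [a], with nonnegative coefficients, bounds the form from below. *)
Lemma convex_toeplitz_ge0 (R : realFieldType) (c a : nat -> R) (N : nat) :
  (forall k, 0 <= c k) -> (forall k, c k.+1 <= c k) ->
  (forall k, 2 * c k.+1 <= c k + c k.+2) ->
  0 <= \sum_(0 <= n < N)
         (2^-1 * c 0%N * a n + \sum_(0 <= j < n) c (n - j)%N * a j) * a n.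
Proof.
move=> c_ge0 c_dec c_convex.
pose d k := c k - c k.+1; pose A j n := \sum_(j <= i < n) a i.
(* The form dominates half of V by induction on N: by Abel summation V picks up
   the new row exactly, and convexity makes the shift of the coefficients d lose. *)
pose V n := \sum_(0 <= j < n) d (n - j.+1)%N * A j n ^+ 2 + c n * A 0%N n ^+ 2.
have d_ge0 k : 0 <= d k by rewrite subr_ge0.
have V_ge0 n : 0 <= V n.
  by apply: addr_ge0; [apply: sumr_ge0 => j _|]; rewrite mulr_ge0 ?sqr_ge0.
suff : 2^-1 * V N <= \sum_(0 <= n < N)
    (2^-1 * c 0%N * a n + \sum_(0 <= j < n) c (n - j)%N * a j) * a n.
  by apply: le_trans; rewrite mulr_ge0.
elim: N => [|N IH]; first by rewrite /V /A !big_geq// expr0n/= mulr0 addr0 mulr0.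
rewrite big_nat_recr//=; apply: le_trans (lerD IH (lexx _)).
(* Expanding the square of [A j N + a N]: the squares keep the old tail sums but shift the index of
   [d], the cross terms are a Toeplitz row by [sum_by_parts], and in the coefficient of [a N ^+ 2]
   the differences telescope to [c 0]. The last two groups make twice the new summand of the
   form. *)
have -> : V N.+1 = \sum_(0 <= j < N.+1) d (N - j)%N * A j N ^+ 2 + c N.+1 * A 0%N N ^+ 2
    + 2 * a N * (\sum_(0 <= j < N.+1) d (N - j)%N * A j N + c N.+1 * A 0%N N)
    + a N ^+ 2 * c 0%N.
  have -> : c 0%N = \sum_(0 <= j < N.+1) d (N - j)%N + c N.+1.
    rewrite big_nat_rev/= add0n (eq_big_nat _ _ (F2 := fun j => - (c j.+1 - c j))).
      by rewrite sumrN telescope_sumr// opprB subrK.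
    by move=> j /andP[_ jN]; rewrite subSS subKn -1?ltnS// /d opprB.
  rewrite /V [A 0%N N.+1]big_nat_recr//= -/(A 0%N N).
  rewrite (eq_big_nat _ _ (F2 := fun j => d (N - j)%N * A j N ^+ 2
     + (2 * a N) * (d (N - j)%N * A j N) + a N ^+ 2 * d (N - j)%N)).
    rewrite [in LHS]big_split [in LHS]big_split/= -!mulr_sumr; ring.
  move=> j /andP[_ jN]; rewrite subSS /A big_nat_recr//=; ring.
rewrite (@sum_by_parts _ d a N c)//.
(* The extra index [j = N] contributes nothing, because [A N N] is an empty sum. *)
have : \sum_(0 <= j < N.+1) d (N - j)%N * A j N ^+ 2 + c N.+1 * A 0%N N ^+ 2 <= V N.
  rewrite /V big_nat_recr//= [A N N]/A (big_geq (leqnn N)) expr0n mulr0 addr0.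
  have : \sum_(0 <= j < N) d (N - j)%N * A j N ^+ 2
         <= \sum_(0 <= j < N) d (N - j.+1)%N * A j N ^+ 2.
    rewrite !big_nat; apply: ler_sum => j /andP[_ jN].
    rewrite ler_wpM2r ?sqr_ge0// -subnSK// /d.
    have := c_convex (N - j.+1)%N; lra.
  have : c N.+1 * A 0%N N ^+ 2 <= c N * A 0%N N ^+ 2 by rewrite ler_wpM2r ?sqr_ge0.
  lra.
lra.
Qed.

(** The sum on the right includes [s m] itself. For [k] at most 1/2 it can be absorbed, since 1/(1 -
    k) <= 1 + 2k <= exp(2k); the induction runs on the majorant [X], which grows by at most this
    factor per step. *)
Lemma discrete_gronwall (R : realType) (s : nat -> R) (B k : R) (N : nat) :
  0 <= B -> 0 <= k <= 2^-1 -> (forall m, 0 <= s m) ->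
  (forall m, (1 <= m <= N)%N -> s m <= B + k * \sum_(1 <= n < m.+1) s n) ->
  (0 < N)%N -> s N <= B * expR (2 * k * N%:R).
Proof.
move=> B0 /andP[k0 k2] s_ge0 H N0.
pose X m := B + k * \sum_(1 <= n < m.+1) s n.
have X_ge0 m : 0 <= X m by rewrite addr_ge0 ?mulr_ge0 ?sumr_ge0.
have XP m : (m <= N)%N -> X m <= B * expR (2 * k * m%:R).
  elim: m => [_|m IH mN].
    by rewrite /X big_geq// mulr0 addr0 mulr0 expR0 mulr1.
  have sX : s m.+1 <= X m.+1 by apply: H.
  have XS : X m.+1 = X m + k * s m.+1 by rewrite /X big_nat_recr//=; ring.
  have {XS}XS : X m.+1 * (1 - k) <= X m.
    by have := ler_wpM2l k0 sX; rewrite XS; lra.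
  have Xk : X m.+1 <= X m * (1 + 2 * k).
    have := ler_wpM2r (_ : 0 <= 1 + 2 * k) XS.
    have : 0 <= k * (1 - 2 * k) * X m.+1 by rewrite !mulr_ge0//; lra.
    by move=> h /(_ _)/wrap[|]; lra.
  rewrite -(natr1 m) mulrDr mulr1 expRD mulrA.
  apply: le_trans Xk _; rewrite ler_pM ?IH ?(ltnW mN) ?expR_ge1Dx//; lra.
by apply: le_trans (XP N (leqnn N)); apply: H; rewrite N0 leqnn.
Qed.

(** * Differences of power functions *)

Definition fdiff (R : realType) (f : R -> R) (x : R) : R := f (x + 1) - f x.

Lemma is_derive_iter_fdiff (R : realType) (m : nat) (f df : R -> R) (x : R) :
  (forall y, x <= y -> is_derive y (1 : R) f (df y)) ->
  is_derive x (1 : R) (iter m (fdiff R) f) (iter m (fdiff R) df x).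
Proof.
elim: m x => [|m IH] x Hf /=; first exact: Hf.
have d1 : is_derive x (1 : R) (iter m (fdiff R) f) (iter m (fdiff R) df x).
  exact: IH.
have d2 : is_derive (x + 1) (1 : R) (iter m (fdiff R) f)
    (iter m (fdiff R) df (x + 1)).
  by apply: IH => y xy; apply: Hf; apply: le_trans xy; rewrite lerDl.
rewrite /fdiff; apply: is_deriveB.
have := @is_derive1_comp R (iter m (fdiff R) f) (fun y => y + 1) x _ 1 d2.
rewrite mulr1; apply.
rewrite -[X in is_derive _ _ _ X]addr0; apply: is_deriveD.
Qed.

Lemma is_derive_powR_shift (R : realType) (s p x : R) : p < x ->
  is_derive x (1 : R) (fun y => (y - p) `^ s) (s * (x - p) `^ (s - 1)).
Proof.
move=> px; have xp : 0 < x - p by rewrite subr_gt0.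
have dx : is_derive x (1 : R) (fun y => y - p) 1.
  by rewrite -[X in is_derive _ _ _ X]addr0; apply: is_deriveD.
rewrite -[X in is_derive _ _ _ X]mulr1.
exact: (@is_derive1_comp R _ (fun y => y - p) x _ _ (@is_derive1_powR R s _ xp) dx).
Qed.

Lemma derivable_oo_LRcontinuous_powR_shift (R : realType) (s p u v : R) :
  0 < s -> p <= u -> u < v ->
  derivable_oo_LRcontinuous (fun y => (y - p) `^ s) u v.
Proof.
move=> s0 pu uv.
have cts x : p < x -> {for x, continuous (fun y => (y - p) `^ s)}.
  by move=> /(is_derive_powR_shift R s)[dx _]; apply/differentiable_continuous/derivable1_diffP.
split.
- move=> x; rewrite in_itv/= => /andP[/(le_lt_trans pu) px _].
  by have [] := is_derive_powR_shift R s p x px.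
- move: pu; rewrite le_eqVlt => /predU1P[<-|/cts]; last exact: cvg_at_right_filter.
  rewrite subrr powR0 ?gt_eqF//; apply: cvg_comp (powR_cvg0 s0) => A [e /= e0 He].
  exists e => // y /= ye py; apply: He; last by rewrite /= subr_gt0.
  by rewrite /= sub0r normrN distrC.
- by apply: cvg_at_left_filter; apply: cts; exact: le_lt_trans uv.
Qed.

Lemma within_continuous_powR (R : realType) (s x y : R) : 0 < s -> 0 <= x < y ->
  {within `[x, y], continuous (fun z : R => z `^ s)}.
Proof.
move=> s0 /andP[x0 xy].
have := derivable_oo_LRcontinuous_within
  (derivable_oo_LRcontinuous_powR_shift R s 0 x y s0 x0 xy).
by rewrite (_ : (fun z => _) = (fun z => z `^ s))//; apply/funext => z; rewrite subr0.
Qed.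

(** The mean value theorem trades one difference for a derivative, which commutes with the remaining
    differences. The mean value point is positive even when [x = 0], so the step can be repeated
    with exponents that have become negative. *)
Lemma iter_fdiff_powR_MVT (R : realType) (m : nat) (s x : R) :
  0 < x \/ 0 <= x /\ 0 < s ->
  exists z, 0 < z /\
    iter m.+1 (fdiff R) (fun y => y `^ s) x =
    s * iter m (fdiff R) (fun y => y `^ (s - 1)) z.
Proof.
move=> xs.
have x0 : 0 <= x by case: xs => [/ltW|[]].
pose g := iter m (fdiff R) (fun y => y `^ s).
have dg (z : R) : 0 < z -> is_derive z (1 : R) g
    (iter m (fdiff R) (fun y => s * y `^ (s - 1)) z).
  by move=> z0; apply: is_derive_iter_fdiff => y zy; apply: is_derive1_powR; exact: lt_le_trans zy.
have fdiffZ k f : iter k (fdiff R) (fun y => s * f y) =1 (fun y => s * iter k (fdiff R) f y).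
  by elim: k => //= k IH y; rewrite /fdiff !IH mulrBr.
have [|||z] := @MVT R g (iter m (fdiff R) (fun y => s * y `^ (s - 1))) x (x + 1).
- by rewrite ltrDl.
- by move=> z; rewrite in_itv/= => /andP[xz _]; apply: dg; exact: le_lt_trans xz.
- case: xs => [x1|[_ s0]].
    apply: derivable_within_continuous => z; rewrite in_itv/= => /andP[xz _].
    by have [] := dg z (lt_le_trans x1 xz).
  (* At [x = 0] the power is in general only continuous. In a difference the shifted term is still
     differentiable there, so continuity descends to the unshifted one and finally to the power
     itself. *)
  rewrite /g; elim: m {g dg} => [|m IH] /=.
    by apply: within_continuous_powR s0 _; rewrite x0 ltrDl ltr01.
  have cshift : {within `[x, x + 1], continuous
      (fun y => iter m (fdiff R) (fun y => y `^ s) (y + 1))}.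
    apply: derivable_within_continuous => z; rewrite in_itv/= => /andP[xz _].
    have z1 : 0 < z + 1 by rewrite ltr_wpDl// (le_trans x0).
    have d1 : is_derive (z + 1) (1 : R) (iter m (fdiff R) (fun y => y `^ s))
        (iter m (fdiff R) (fun y => s * y `^ (s - 1)) (z + 1)).
      by apply: is_derive_iter_fdiff => y zy; apply: is_derive1_powR; exact: lt_le_trans zy.
    have d2 : is_derive z (1 : R) (fun y => y + 1) 1.
      by rewrite -[X in is_derive _ _ _ X]addr0; apply: is_deriveD.
    by have [] := @is_derive1_comp R _ (fun y => y + 1) z _ _ d1 d2.
  by move=> z; apply: cvgB; [exact: cshift|exact: IH].
rewrite in_itv/= addrAC subrr add0r mulr1 => /andP[xz _] gE.
exists z; split; first exact: le_lt_trans xz.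
by rewrite -fdiffZ -gE.
Qed.

Lemma iter_fdiff_powR (R : realType) (m : nat) (s x : R) :
  0 < x ->
  exists z, 0 < z /\ iter m (fdiff R) (fun y => y `^ s) x =
    (\prod_(i < m) (s - i%:R)) * z `^ (s - m%:R).
Proof.
elim: m s x => [|m IH] s x x0.
  by exists x; rewrite big_ord0 mul1r subr0.
have [|z [z0 ->]] := iter_fdiff_powR_MVT R m s x; first by left.
have [w [w0 ->]] := IH (s - 1) z z0.
exists w; split => //; rewrite big_ord_recl subr0 mulrA; congr (_ * _ * _).
  by apply: eq_bigr => i _; rewrite lift0 -(natr1 i); ring.
by congr (_ `^ _); rewrite -(natr1 m); ring.
Qed.

(** The sign of a difference is thus that of the falling factorial. For 1 < s < 2 this is positive,
    negative, positive at orders 2, 3 and 4, which makes the second differences nonnegative,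
    nonincreasing and convex. *)
Lemma iterS_fdiff_powR (R : realType) (m : nat) (s x : R) :
  0 <= x -> 0 < s ->
  exists z, 0 < z /\ iter m.+1 (fdiff R) (fun y => y `^ s) x =
    (\prod_(i < m.+1) (s - i%:R)) * z `^ (s - m.+1%:R).
Proof.
move=> x0 s0.
have [|z [z0 ->]] := iter_fdiff_powR_MVT R m s x; first by right.
have [w [w0 ->]] := iter_fdiff_powR R m (s - 1) z z0.
exists w; split => //; rewrite big_ord_recl subr0 mulrA; congr (_ * _ * _).
  by apply: eq_bigr => i _; rewrite lift0 -(natr1 i); ring.
by congr (_ `^ _); rewrite -(natr1 m); ring.
Qed.

(* Convexity of the second differences at the index where |x - 1| has its kink. *)
Lemma powR_2_3 (R : realType) (s : R) : s <= 2 -> 0 <= 7 - 4 * 2 `^ s + 3 `^ s :> R.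
Proof.
move=> s2; rewrite /powR !gt_eqF//.
pose d := 2 - s; pose u := d * ln 3 :> R.
have d0 : 0 <= d by rewrite subr_ge0.
have -> : s * ln 3 = 2 * ln 3 - u :> R by rewrite /u /d; ring.
have -> : s * ln 2 = 2 * ln 2 - d * ln 2 :> R by rewrite /d; ring.
rewrite !expRD !expRM_natl !lnK ?posrE//.
(* 16 * 2^(-d) <= 9 * 3^(-d) + 7 by weighted AM-GM, since 3^9 <= 2^16. *)
have ln23 : 9 / 16 * ln 3 <= ln 2 :> R.
  have : ln (3 ^+ 9) <= ln (2 ^+ 16) :> R.
    by rewrite ler_ln ?posrE ?exprn_gt0// -!natrX ler_nat.
  rewrite !lnXn// -[_ *+ 9]mulr_natl -[_ *+ 16]mulr_natl; lra.
have h1 : expR (- (d * ln 2)) <= expR (- (9 / 16 * u)).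
  by rewrite ler_expR lerN2 /u mulrCA ler_wpM2l.
have h2 : 16 * expR (- (9 / 16 * u)) <= 9 * expR (- u) + 7.
  have -> : expR (- u) = expR (- (9 / 16 * u)) * expR (- (7 / 16 * u)).
    by rewrite -expRD; congr expR; field.
  have e1 : expR (- (9 / 16 * u)) * expR (9 / 16 * u) = 1.
    by rewrite -expRD addNr expR0.
  (* The tangent bounds 1 + x <= exp x give 9 exp(-7u/16) + 7 exp(9u/16) >= 16, as the terms linear
     in u cancel; it remains to multiply by exp(-9u/16). *)
  move: e1 (expR_ge1Dx (9 / 16 * u)) (expR_ge1Dx (- (7 / 16 * u))).
  have := expR_gt0 (- (9 / 16 * u)).
  set e := expR _; set q := expR _; set p := expR _ => e0 e1 hq hp.
  have -> : 9 * (e * p) + 7 = (9 * p + 7 * q) * e.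
    by rewrite -[X in _ + X](mulr1 7) -e1; ring.
  by rewrite ler_pM2r//; lra.
lra.
Qed.

Definition powR_diff2 (R : realType) (s : R) (k : nat) : R :=
  (k%:R + 1) `^ s - 2 * k%:R `^ s + `|k%:R - 1| `^ s.

Lemma powR_diff2S (R : realType) (s : R) (k : nat) :
  powR_diff2 R s k.+1 = iter 2 (fdiff R) (fun y => y `^ s) k%:R.
Proof.
rewrite /powR_diff2 /= /fdiff -(natr1 k) addrK ger0_norm//; ring.
Qed.

Lemma powR_diff2_0 (R : realType) (s : R) : 0 < s -> powR_diff2 R s 0 = 2.
Proof.
move=> s0; rewrite /powR_diff2 add0r sub0r normrN normr1 powR1 powR0 ?gt_eqF//.
by rewrite mulr0 subr0.
Qed.

Lemma powR_diff2_ge0 (R : realType) (s : R) (k : nat) :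
  1 < s < 2 -> 0 <= powR_diff2 R s k.
Proof.
move=> /andP[s1 s2]; have s0 : 0 < s by lra.
case: k => [|k]; first by rewrite powR_diff2_0.
rewrite powR_diff2S; have [//|z [z0 ->]] := iterS_fdiff_powR R 1 s k%:R _ s0.
rewrite mulr_ge0 ?powR_ge0// !big_ord_recl big_ord0/= /bump/= mulr1 subr0.
by rewrite mulr_ge0//; lra.
Qed.

Lemma powR_diff2_nincr (R : realType) (s : R) (k : nat) :
  1 < s < 2 -> powR_diff2 R s k.+1 <= powR_diff2 R s k.
Proof.
move=> /andP[s1 s2]; have s0 : 0 < s by lra.
case: k => [|k].
  (* The claim at index 0 is 2^s - 2 <= 2. *)
  rewrite powR_diff2_0// powR_diff2S /= /fdiff !add0r powR1 powR0 ?gt_eqF//.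
  have : 2 `^ s <= 2 `^ 2 :> R by rewrite ler_powR// ?ler1n// ltW.
  rewrite -[_ `^ 2]/(_ `^ 2%:R) powR_mulrn// expr2; lra.
rewrite -subr_le0 !powR_diff2S -natr1.
have [//|z [z0 h]] := iterS_fdiff_powR R 2 s k%:R _ s0.
rewrite -[leLHS]/(iter 3 (fdiff R) (fun y => y `^ s) k%:R) h.
rewrite mulr_le0_ge0 ?powR_ge0// !big_ord_recl big_ord0/= /bump/= mulr1 subr0.
by do 2 (rewrite mulr_ge0_le0//; [lra|]); rewrite /bump/=; lra.
Qed.

Lemma powR_diff2_convex (R : realType) (s : R) (k : nat) :
  1 < s < 2 -> 2 * powR_diff2 R s k.+1 <= powR_diff2 R s k + powR_diff2 R s k.+2.
Proof.
move=> /andP[s1 s2]; have s0 : 0 < s by lra.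
case: k => [|k].
  (* The claim at index 0 is 2 (2^s - 2) <= 2 + (3^s - 2 2^s + 1), a rearrangement of [powR_2_3]. *)
  rewrite powR_diff2_0// !powR_diff2S /= /fdiff !add0r powR1 powR0 ?gt_eqF//.
  have := powR_2_3 R s (ltW s2).
  have -> : 1 + 1 = 2 :> R by [].
  have -> : 2 + 1 = 3 :> R by rewrite natr1.
  lra.
have [//|z [z0 h]] := iterS_fdiff_powR R 3 s k%:R _ s0.
have : 0 <= iter 4 (fdiff R) (fun y => y `^ s) k%:R.
  rewrite h mulr_ge0 ?powR_ge0// !big_ord_recl big_ord0/= /bump/= mulr1 subr0.
  rewrite mulr_ge0//; first lra.
  rewrite mulr_ge0//; first lra.
  by rewrite mulr_le0//; rewrite /bump/=; lra.
rewrite !powR_diff2S -(natr1 k.+1) -(natr1 k).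
rewrite [X in 0 <= X]/= /fdiff /=; lra.
Qed.

(** * Quadrature weights *)

(* No measurability is required, since the integral of a nonnegative function
   is a supremum over the simple functions below it. *)
Lemma normr_Rintegral_itv_le (R : realType) (f : R -> R) (u v M : R) :
  u <= v -> 0 <= M -> (forall x, u <= x <= v -> `|f x| <= M) ->
  `|\int[@lebesgue_measure R]_(x in `[u, v]) f x| <= M * (v - u).
Proof.
move=> uv M0 fM.
have muE : (M%:E * (@lebesgue_measure R) `[u, v] = (M * (v - u))%:E)%E.
  rewrite lebesgue_measure_itv/= lte_fin; case: ltP => // vu.
  by rewrite (le_anti (introT andP (conj uv vu))) subrr mulr0 mule0.
have H (g : R -> \bar R) : (forall x, `[u, v]%classic x -> 0 <= g x)%E ->
    (forall x, `[u, v]%classic x -> g x <= M%:E)%E ->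
    (\int[@lebesgue_measure R]_(x in `[u, v]) g x <= (M * (v - u))%:E)%E.
  move=> g0 gM; rewrite -muE -integral_cst// !ge0_integralE//.
  apply: le_ereal_sup => _ [h hg <-]; exists h => // x.
  apply: (le_trans (hg x)); rewrite /patch; case: ifPn => // /set_mem; exact: gM.
rewrite /Rintegral integralE; set p := integral _ _ _; set n := integral _ _ _.
have p0 : (0 <= p)%E by apply: integral_ge0.
have n0 : (0 <= n)%E by apply: integral_ge0.
have pM : (p <= (M * (v - u))%:E)%E.
  apply: H => // x Dx; rewrite funeposE ge_max !lee_fin M0 andbT.
  apply: le_trans (fM x _); first exact: ler_norm.
  by move: Dx; rewrite /= in_itv.
have nM : (n <= (M * (v - u))%:E)%E.
  apply: H => // x Dx; rewrite funenegE ge_max !lee_fin M0 andbT.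
  apply: le_trans (fM x _); first by rewrite -normrN ler_norm.
  by move: Dx; rewrite /= in_itv.
move: p n p0 n0 pM nM => [p| |] [n| |]//; rewrite !lee_fin /= => p0 n0 pM nM.
by rewrite ler_norml; apply/andP; split; lra.
Qed.

(** The inner interval has length at most [tau], and the outer integral is an average over an
    interval of length [tau]. All arguments t - s lie between 0 and [T], where [g] is controlled. *)
Lemma weight_bound (R : realType) (T tau M : R) (g : R -> R) (n j : nat) :
  0 < tau -> 0 <= M -> (forall x, 0 <= x <= T -> `|g x| <= M) ->
  (1 <= j <= n)%N -> n%:R * tau <= T -> `|weight tau g n j| <= M * tau.
Proof.
move=> tau0 M0 gM /andP[j1 jn] nT.
have jE : j%:R = j.-1%:R + 1 :> R by rewrite natr1 prednK.
have nE : n%:R = n.-1%:R + 1 :> R by rewrite natr1 prednK// (leq_trans j1).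
rewrite /weight normrM gtr0_norm ?invr_gt0// mulrC ler_pdivrMr//.
have jn1 : j.-1%:R * tau <= n.-1%:R * tau.
  by rewrite ler_pM2r// ler_nat -!subn1 leq_sub2r.
have j0 : 0 <= j.-1%:R * tau by rewrite mulr_ge0// ltW.
rewrite [leRHS](_ : _ = M * tau * (n%:R * tau - n.-1%:R * tau)); last by rewrite nE; ring.
apply: normr_Rintegral_itv_le; first by rewrite nE; lra.
  by rewrite mulr_ge0// ltW.
move=> t /andP[t1 t2].
apply: le_trans (normr_Rintegral_itv_le _ _ _ _ M _ M0 _) _.
- by rewrite le_min (le_trans jn1)//= ler_pM2r// ler_nat leq_pred.
- by move=> s; rewrite le_min => /andP[s1 /andP[s2 s3]]; apply: gM; lra.
- rewrite ler_wpM2l// lerBlDr ge_min; apply/orP; right.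
  by rewrite jE; lra.
Qed.

(** Here [f] may blow up at [m], as (t - s)^(al - 1) does at s = t. The usual theorem applies on
    [p, m - 1/(n+1)]; monotone convergence on one side and left continuity of [F] at [m] on the
    other give the limit. *)
Lemma ge0_FTC2_at_left (R : realType) (f F : R -> R) (p m : R) : p < m ->
  (forall x, p <= x < m -> 0 <= f x) -> measurable_fun setT f ->
  (forall x, p <= x < m -> {for x, continuous f}) ->
  derivable_oo_LRcontinuous F p m -> {in `]p, m[, derive1 F =1 f} ->
  (\int[@lebesgue_measure R]_(x in `[p, m]) (f x)%:E = (F m - F p)%:E)%E.
Proof.
move=> pm f0 mf cf [dF Fp Fm] F'f.
rewrite -integral_itv_bndo_bndc; last first.
  by apply/measurable_EFinP; exact: measurable_funS mf.
rewrite itv_bnd_open_bigcup.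
pose S (n : nat) : set R := `[p, m - n.+1%:R^-1]%classic.
rewrite -[bigcup _ _]/(\bigcup_n S n).
have cv : (\int[@lebesgue_measure R]_(x in S n) (f x)%:E)%E @[n --> \oo]
    --> (\int[@lebesgue_measure R]_(x in \bigcup_n S n) (f x)%:E)%E.
  apply: ge0_nondecreasing_set_cvg_integral => //.
  - apply/nondecreasing_seqP => n; rewrite subsetEset; apply: subset_itvl.
    by rewrite bnd_simp lerD2l lerN2 lef_pV2 ?posrE// ler_nat.
  - by move=> n; exact: measurable_itv.
  - by move=> n; apply/measurable_EFinP; exact: measurable_funS mf.
  - move=> n x; rewrite /S/= in_itv/= lee_fin => /andP[px xm]; apply: f0.
    by rewrite px (le_lt_trans xm)// gtrBl.
apply: (cvg_unique _ cv) => //.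
have H : F (m - n.+1%:R^-1) - F p @[n --> \oo] --> F m - F p.
  apply: cvgB; last exact: cvg_cst.
  move/cvg_at_leftP : Fm; apply; split => [n|]; first by rewrite gtrBl.
  by rewrite -[X in _ --> X]subr0; apply: cvgB; [exact: cvg_cst|exact: cvg_harmonic].
have : (fun n => (F (m - n.+1%:R^-1) - F p)%:E) @ \oo --> (F m - F p)%:E.
  by apply: cvg_EFin; [exact: nearW|exact: H].
(* For small [n] the truncated interval may be empty, so the two sequences are compared only for
   large [n]. *)
apply: cvg_trans; apply: near_eq_cvg; near=> n => /=.
have pn : p < m - n.+1%:R^-1.
  rewrite ltrBrDr addrC -ltrBrDr; near: n.
  have mp : 0 < m - p by rewrite subr_gt0.
  exact: (near_infty_natSinv_lt (PosNum mp)).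
have nm : m - n.+1%:R^-1 < m by rewrite gtrBl.
rewrite (@continuous_FTC2 R f F)//.
- apply: continuous_in_subspaceT => x; rewrite inE/= in_itv/= => /andP[px xn].
  by apply: cf; rewrite px (le_lt_trans xn).
- split => //.
  + by move=> x; rewrite in_itv/= => /andP[px xn]; apply: dF; rewrite in_itv/= px (lt_trans xn).
  + apply/cvg_at_left_filter/differentiable_continuous/derivable1_diffP.
    by apply: dF; rewrite in_itv/= pn.
- by move=> x; rewrite in_itv/= => /andP[px xn]; apply: F'f; rewrite in_itv/= px (lt_trans xn).
Unshelve. all: by end_near.
Qed.

(** [K] stands for the value of Gamma, of which only the sign enters: its inverse stays opaque in
    the algebra, so the formula also covers [K = 0], where both sides vanish by the convention on
    inverses. *)
Lemma integral_powR_reflect (R : realType) (al K p m t : R) :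
  0 < al -> 0 <= K -> p <= m -> m <= t ->
  \int[@lebesgue_measure R]_(s in `[p, m]) ((t - s) `^ (al - 1) / K) =
  ((t - p) `^ al - (t - m) `^ al) / (al * K).
Proof.
move=> al0 K0; rewrite le_eqVlt => /predU1P[->|pm] mt.
  by rewrite set_itv1 Rintegral_set1 subrr mul0r.
have aln0 : al != 0 by rewrite gt_eqF.
pose F s := - (al^-1 / K) * (t - s) `^ al.
have dts s : is_derive s (1 : R) (fun s => t - s) (-1).
  by rewrite -[-1]add0r; apply: is_deriveB.
have dpow be s : s < t ->
    is_derive s (1 : R) (fun s => (t - s) `^ be) (be * (t - s) `^ (be - 1) * -1).
  move=> st; have ts : 0 < t - s by rewrite subr_gt0.
  exact: (@is_derive1_comp R _ (fun y => t - y) s _ _ (@is_derive1_powR R be _ ts) (dts s)).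
have cpow be s : s < t -> {for s, continuous (fun s => (t - s) `^ be)}.
  by move=> /(dpow be)[d1 _]; apply/differentiable_continuous/derivable1_diffP.
have dF s : s < t -> is_derive s (1 : R) F ((t - s) `^ (al - 1) / K).
  move=> /(dpow al) d1.
  have -> : (t - s) `^ (al - 1) / K =
      - (al^-1 / K) * (al * (t - s) `^ (al - 1) * -1).
    by set k := K^-1; field.
  exact: is_deriveZ.
have cts s : s < t -> {for s, continuous (fun s => (t - s) `^ (al - 1) / K)}.
  by move=> /(cpow (al - 1)) c1; apply: cvgM; [exact: c1|exact: cvg_cst].
rewrite /Rintegral (@ge0_FTC2_at_left R _ F)//.
- by rewrite /= /F invfM; set k := K^-1; field.
- by move=> x _; rewrite divr_ge0 ?powR_ge0.
- apply: measurable_funM => //; apply: (measurableT_comp (measurable_powR _)) => //.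
  exact: measurable_funB.
- by move=> x /andP[_ xm]; apply: cts; exact: lt_le_trans mt.
- split.
  + move=> x; rewrite in_itv/= => /andP[_ xm].
    by have [] := dF x (lt_le_trans xm mt).
  + apply/cvg_at_right_filter/differentiable_continuous/derivable1_diffP.
    by have [] := dF p (lt_le_trans pm mt).
  + apply: cvgM; first exact: cvg_cst.
    move: mt; rewrite le_eqVlt => /predU1P[<-|/(cpow al)]; last exact: cvg_at_left_filter.
    rewrite subrr powR0//; apply: cvg_comp (powR_cvg0 al0) => A [e /= e0 He].
    exists e => // y ye ym; apply: He; last by rewrite /= subr_gt0.
    by rewrite /= sub0r normrN.
- move=> x; rewrite in_itv/= => /andP[_ xm].
  by have [_] := dF x (lt_le_trans xm mt); rewrite derive1E.
Qed.

Lemma Rintegral_powR_shift (R : realType) (s p u v : R) :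
  0 < s -> p <= u -> u < v ->
  lebesgue_measure.-integrable `[u, v] (EFin \o (fun x : R => (x - p) `^ s)) /\
  \int[@lebesgue_measure R]_(x in `[u, v]) (x - p) `^ s =
  ((v - p) `^ (s + 1) - (u - p) `^ (s + 1)) / (s + 1).
Proof.
move=> s0 pu uv; have s1 : 0 < s + 1 by rewrite addr_gt0.
have c1 := derivable_oo_LRcontinuous_within
  (derivable_oo_LRcontinuous_powR_shift R s p u v s0 pu uv).
have [d2 r2 l2] := derivable_oo_LRcontinuous_powR_shift R (s + 1) p u v s1 pu uv.
have dF x : p < x ->
    is_derive x (1 : R) (fun y => (s + 1)^-1 * (y - p) `^ (s + 1)) ((x - p) `^ s).
  move=> /(is_derive_powR_shift R (s + 1)); rewrite addrK => dx.
  have -> : (x - p) `^ s = (s + 1)^-1 * ((s + 1) * (x - p) `^ s).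
    by rewrite mulKf// gt_eqF.
  exact: is_deriveZ.
split; first by apply: continuous_compact_integrable; [exact: segment_compact|exact: c1].
rewrite /Rintegral (@continuous_FTC2 R _ (fun y => (s + 1)^-1 * (y - p) `^ (s + 1)))//=.
- by rewrite -mulrBr mulrC.
- split.
  + move=> x; rewrite in_itv/= => /andP[/(le_lt_trans pu) px _].
    by have [] := dF x px.
  + by apply: cvgM; [exact: cvg_cst|exact: r2].
  + by apply: cvgM; [exact: cvg_cst|exact: l2].
- move=> x; rewrite in_itv/= => /andP[/(le_lt_trans pu) px _].
  by have [_] := dF x px; rewrite derive1E.
Qed.

(** Each of the two integrations raises the exponent by one and takes a difference over one cell;
    homogeneity then extracts [tau]. The indices are shifted because the scheme counts from 1 and
    the Toeplitz sequence from 0. *)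
Lemma weight_beta_kernel (R : realType) (al tau : R) (n j : nat) :
  0 < al -> 0 < tau -> (j <= n)%N ->
  weight tau (beta_kernel al) n.+1 j.+1 =
  tau^-1 * tau `^ (al + 1) / (al * (al + 1) * Gamma al) *
  (if j == n then 2^-1 * powR_diff2 R (al + 1) 0 else powR_diff2 R (al + 1) (n - j)).
Proof.
move=> al0 tau0 jn; have al1 : 0 < al + 1 by rewrite addr_gt0.
have G0 : 0 <= Gamma al.
  by apply: Rintegral_ge0 => x _; rewrite mulr_ge0 ?powR_ge0 ?expR_ge0.
have nn1 : n%:R * tau < n.+1%:R * tau by rewrite ltr_pM2r// ltr_nat.
have jj1 : j%:R * tau < j.+1%:R * tau by rewrite ltr_pM2r// ltr_nat.
have tjn : j%:R * tau <= n%:R * tau by rewrite ler_pM2r// ler_nat.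
rewrite /weight /= (eq_Rintegral (@lebesgue_measure R) (g := fun t : R => ((t - j%:R * tau) `^ al
    - (t - Num.min t (j.+1%:R * tau)) `^ al) * (al * Gamma al)^-1)); last first.
  move=> t; rewrite inE/= in_itv/= => /andP[t1 t2].
  rewrite -integral_powR_reflect//; first by rewrite le_min (ltW jj1) (le_trans tjn).
  by rewrite ge_min lexx.
(* On the diagonal the inner integral stops at [t], so one power drops out and the value is 1
   instead of the second difference 2: this is the halving. *)
have [ej|nj] := eqVneq j n.
  rewrite powR_diff2_0// ej.
  have [itg itgE] := Rintegral_powR_shift R al (n%:R * tau) _ _ al0 (lexx _) nn1.
  rewrite (eq_Rintegral (@lebesgue_measure R)
    (g := fun t : R => (t - n%:R * tau) `^ al * (al * Gamma al)^-1)); last first.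
    move=> t; rewrite inE/= in_itv/= => /andP[t1 t2].
    by rewrite (min_idPl t2) subrr powR0 ?gt_eqF// subr0.
  rewrite RintegralZr// itgE subrr powR0 ?gt_eqF// subr0 -mulrBl -natrB// subSnn mul1r.
  by rewrite mulVf// mulr1 !invfM; ring.
have {}jn : (j < n)%N by rewrite ltn_neqAle nj.
have tj1n : j.+1%:R * tau <= n%:R * tau by rewrite ler_pM2r// ler_nat.
have [itg1 E1] := Rintegral_powR_shift R al _ _ _ al0 tjn nn1.
have [itg2 E2] := Rintegral_powR_shift R al _ _ _ al0 tj1n nn1.
rewrite (eq_Rintegral (@lebesgue_measure R) (g := fun t : R => ((t - j%:R * tau) `^ al
    - (t - j.+1%:R * tau) `^ al) * (al * Gamma al)^-1)); last first.
  move=> t; rewrite inE/= in_itv/= => /andP[t1 t2].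
  by rewrite (min_idPr (le_trans tj1n t1)).
rewrite RintegralZr//; last exact: (integrableB _ itg1 itg2).
rewrite RintegralB// E1 E2.
have pw (x : R) y : 0 <= y - x ->
    (y * tau - x * tau) `^ (al + 1) = (y - x) `^ (al + 1) * tau `^ (al + 1).
  by move=> xy; rewrite -mulrBl powRM// ltW.
have kn : (n - j)%:R = n%:R - j%:R :> R by rewrite natrB// ltnW.
have jn1 : j%:R + 1 <= n%:R :> R by rewrite natr1 ler_nat.
rewrite !pw; [|rewrite -?(natr1 n) -?(natr1 j); lra..].
rewrite /powR_diff2 kn ger0_norm; last lra.
rewrite -(natr1 n) -(natr1 j) !invfM.
have -> : n%:R + 1 - j%:R = n%:R - j%:R + 1 :> R by ring.
have -> : n%:R + 1 - (j%:R + 1) = n%:R - j%:R :> R by ring.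
have -> : n%:R - (j%:R + 1) = n%:R - j%:R - 1 :> R by ring.
ring.
Qed.

Lemma sum_weight_beta_ge0 (R : realType) (al tau : R) (N : nat) (v : nat -> R) :
  0 < al < 1 -> 0 < tau ->
  0 <= \sum_(1 <= n < N.+1)
         (\sum_(1 <= j < n.+1) weight tau (beta_kernel al) n j * v j) * v n.
Proof.
move=> /andP[al0 al1] tau0; have s12 : 1 < al + 1 < 2 by apply/andP; split; lra.
have G0 : 0 <= Gamma al.
  by apply: Rintegral_ge0 => x _; rewrite mulr_ge0 ?powR_ge0 ?expR_ge0.
set c := powR_diff2 R (al + 1).
set K := tau^-1 * tau `^ (al + 1) / (al * (al + 1) * Gamma al).
have K0 : 0 <= K.
  by rewrite !(mulr_ge0, invr_ge0) ?powR_ge0// ?invr_ge0 ?mulr_ge0//; lra.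
rewrite big_add1/= (eq_bigr (fun n => K * ((2^-1 * c 0%N * v n.+1
    + \sum_(0 <= j < n) c (n - j)%N * v j.+1) * v n.+1))).
  rewrite -mulr_sumr mulr_ge0//.
  apply: (convex_toeplitz_ge0 R c (fun n => v n.+1)) => k.
  - exact: powR_diff2_ge0.
  - exact: powR_diff2_nincr.
  - exact: powR_diff2_convex.
move=> n _; rewrite big_add1/= big_nat_recr//= weight_beta_kernel// eqxx.
rewrite (eq_big_nat _ _ (F2 := fun j => K * (c (n - j)%N * v j.+1))).
  rewrite -mulr_sumr -/K -/c; ring.
move=> j /andP[_ jn].
by rewrite weight_beta_kernel ?(ltnW jn)// ltn_eqF// mulrA.
Qed.

(** * Inner products in L^2(a, b) *)

Definition L2dot {R : realType} (a b : R) (g h : R -> R) : R :=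
  \int[@lebesgue_measure R]_(x in `]a, b[) (g x * h x).

Lemma inL2_measurable (R : realType) (a b : R) (g : R -> R) :
  inLp 2%:E a b g -> measurable_fun `]a, b[ g.
Proof.
rewrite /inLp inE => /andP[/[!inE]/= mg _].
exact/(measurable_restrictT g).
Qed.

Lemma inL2_mul_integrable (R : realType) (a b : R) (g h : R -> R) :
  inLp 2%:E a b g -> inLp 2%:E a b h ->
  mu.-integrable `]a, b[ (EFin \o (fun x => g x * h x)).
Proof.
move=> gL hL; have /Lfun1_integrable := Lfun2_mul_Lfun1 gL hL.
move=> i; apply/integrable_mkcond => //.
apply: eq_integrable i => // x _ /=; rewrite !patchE /=.
by case: ifP => //; rewrite mul0r.
Qed.

Lemma inL2P (R : realType) (a b : R) (g : R -> R) :
  measurable_fun `]a, b[ g ->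
  mu.-integrable `]a, b[ (EFin \o (fun x => g x * g x)) -> inLp 2%:E a b g.
Proof.
move=> mg ig0; have ig := (@integrable_mkcond _ (measurableTypeR R)
  R mu `]a, b[ _ (measurable_itv _)).1 ig0.
rewrite /inLp inE; apply/andP; split; rewrite inE/=.
  exact/(measurable_restrictT g).
rewrite /finite_norm unlock; apply: poweR_lty.
case/integrableP : ig => _; apply: le_lt_trans.
rewrite le_eqVlt; apply/orP; left; apply/eqP; apply: eq_integral => x _ /=.
rewrite !patchE; case: ifPn => _ /=; last by rewrite normr0 powR0.
by rewrite powR_mulrn// normrM expr2.
Qed.

Lemma L2norm_ge0 (R : realType) (a b : R) (g : R -> R) : 0 <= L2norm a b g.
Proof. by rewrite fine_ge0// Lnorm_ge0. Qed.

Lemma L2norm_sqr (R : realType) (a b : R) (g : R -> R) :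
  inLp 2%:E a b g -> L2norm a b g ^+ 2 = L2dot a b g g.
Proof.
move=> gL; have /andP[/[!inE]/= mg fg] : g \_ `]a, b[ \in Lfun (@lebesgue_measure R) 2%:E := gL.
have fN : ('N[mu]_2%:E[EFin \o g \_ `]a, b[] \is a fin_num)%E.
  by rewrite ge0_fin_numE ?Lnorm_ge0.
rewrite -[LHS]powR_mulrn ?L2norm_ge0//; apply: EFin_inj.
rewrite -poweR_EFin /L2norm fineK// poweR_Lnorm// /L2dot /Rintegral fineK; last first.
  exact: (integrable_fin_num _ (inL2_mul_integrable _ _ _ _ _ gL gL)).
rewrite [RHS]integral_mkcond; apply: eq_integral => x _ /=.
rewrite !patchE; case: ifPn => _ /=; last by rewrite normr0 powR0.
by rewrite powR_mulrn// -normrX ger0_norm ?sqr_ge0// expr2.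
Qed.

Lemma L2dotC (R : realType) (a b : R) (g h : R -> R) : L2dot a b g h = L2dot a b h g.
Proof. by apply: eq_Rintegral => x _; rewrite mulrC. Qed.

Lemma normr_L2dot_le (R : realType) (a b : R) (g h : R -> R) :
  inLp 2%:E a b g -> inLp 2%:E a b h ->
  `|L2dot a b g h| <= L2norm a b g * L2norm a b h.
Proof.
move=> gL hL.
have /andP[/[!inE]/= mg fg] : g \_ `]a, b[ \in Lfun (@lebesgue_measure R) 2%:E := gL.
have /andP[/[!inE]/= mh fh] : h \_ `]a, b[ \in Lfun (@lebesgue_measure R) 2%:E := hL.
rewrite -lee_fin /L2norm EFinM !fineK ?ge0_fin_numE ?Lnorm_ge0//.
have pq : 2^-1 + 2^-1 = 1 :> R by field.
have := @hoelder _ _ _ mu _ _ 2 2 mg mh (ltr0n _ 2) (ltr0n _ 2) pq.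
apply: le_trans.
rewrite Lnorm1 EFin_normr_Rintegral//; last exact: inL2_mul_integrable.
apply: le_trans (le_abse_integral _ _ _) _ => //.
  exact: measurable_int (inL2_mul_integrable _ _ _ _ _ gL hL).
rewrite integral_mkcond le_eqVlt; apply/orP; left; apply/eqP; apply: eq_integral => x _ /=.
by rewrite !patchE; case: ifPn => //= _; rewrite mul0r normr0.
Qed.

Lemma inL2D (R : realType) (a b : R) (g h : R -> R) :
  inLp 2%:E a b g -> inLp 2%:E a b h -> inLp 2%:E a b (g \+ h).
Proof.
move=> gL hL; rewrite /inLp.
have -> : (g \+ h) \_ `]a, b[ = g \_ `]a, b[ + h \_ `]a, b[.
  by apply/funext => x; rewrite fctE !patchE; case: ifP => //; rewrite addr0.
have p1 : (1 <= 2%:E :> \bar R)%E by rewrite lee1n.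
by have [_] := Lfun_addr_closed (@lebesgue_measure R) p1; apply.
Qed.

Lemma inL2M_bounded (R : realType) (a b M : R) (k g : R -> R) :
  measurable_fun `]a, b[ k -> (forall x, a < x < b -> `|k x| <= M) ->
  inLp 2%:E a b g -> inLp 2%:E a b (k \* g).
Proof.
move=> mk kM gL; have mg := inL2_measurable _ _ _ _ gL.
apply: inL2P; first exact: measurable_funM.
apply: (le_integrable _ _ _ (integrableZl _ (M ^+ 2) (inL2_mul_integrable _ _ _ _ _ gL gL))) => //.
  by apply/measurable_EFinP; do 2 apply: measurable_funM => //.
move=> x /=; rewrite in_itv/= => /kM xM; rewrite lee_fin -!expr2 exprMn normrM [leRHS]normrM.
by rewrite ler_wpM2r// !normrX ler_sqr ?nnegrE// (le_trans xM) ?ler_norm.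
Qed.

Lemma inL2Z (R : realType) (a b c : R) (g : R -> R) :
  inLp 2%:E a b g -> inLp 2%:E a b (fun x => c * g x).
Proof. by apply: (@inL2M_bounded _ _ _ `|c| (cst c)). Qed.

Lemma inL2_cst0 (R : realType) (a b : R) : inLp 2%:E a b (fun=> 0 : R).
Proof.
apply: inL2P => //; rewrite (_ : _ \o _ = cst 0%E); first exact: integrable0.
by apply/funext => x /=; rewrite mulr0.
Qed.

Lemma inL2_sum (R : realType) (a b : R) (I : eqType) (s : seq I)
    (g : I -> R -> R) : (forall i, i \in s -> inLp 2%:E a b (g i)) ->
  inLp 2%:E a b (fun x => \sum_(i <- s) g i x).
Proof.
elim: s => [|i s IH] gL.
  rewrite (_ : (fun x => _) = fun=> 0); first exact: inL2_cst0.
  by apply/funext => x; rewrite big_nil.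
rewrite (_ : (fun x => _) = g i \+ (fun x => \sum_(j <- s) g j x)).
  apply: inL2D; first by apply: gL; rewrite mem_head.
  by apply: IH => j js; apply: gL; rewrite inE js orbT.
by apply/funext => x; rewrite big_cons.
Qed.

Lemma continuous_inL2 (R : realType) (a b : R) (g : R -> R) :
  continuous g -> inLp 2%:E a b g.
Proof.
move=> cg; apply: inL2P.
  by apply: measurable_funTS; apply: continuous_measurable_fun; exact: cg.
apply: (@integrableS _ (measurableTypeR R) _ _ `[a, b]) => //.
  exact: subset_itv_oo_cc.
apply: continuous_compact_integrable; first exact: segment_compact.
by apply: continuous_subspaceT => x; apply: cvgM; exact: cg.
Qed.

Lemma L2dotDl (R : realType) (a b : R) (f g h : R -> R) :
  inLp 2%:E a b f -> inLp 2%:E a b g -> inLp 2%:E a b h ->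
  L2dot a b (f \+ g) h = L2dot a b f h + L2dot a b g h.
Proof.
move=> fL gL hL; rewrite /L2dot -RintegralD//; [|exact: inL2_mul_integrable..].
by apply: eq_Rintegral => x _ /=; rewrite mulrDl.
Qed.

Lemma L2dotZl (R : realType) (a b c : R) (g h : R -> R) :
  inLp 2%:E a b g -> inLp 2%:E a b h ->
  L2dot a b (fun x => c * g x) h = c * L2dot a b g h.
Proof.
move=> gL hL; rewrite /L2dot -RintegralZl//; last exact: inL2_mul_integrable.
by apply: eq_Rintegral => x _ /=; rewrite mulrA.
Qed.

Lemma integrableZl_EFin d (T : measurableType d) (R : realType)
    (nu : {measure set T -> \bar R}) (D : set T) (c : R) (f : T -> R) :
  measurable D -> nu.-integrable D (EFin \o f) ->
  nu.-integrable D (EFin \o (fun x => c * f x)).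
Proof.
move=> mD fi; rewrite (_ : _ \o _ = (fun x => c%:E * (f x)%:E)%E).
  exact: integrableZl.
by apply/funext => x; rewrite /= EFinM.
Qed.

Lemma integrable_sum_seq d (T : measurableType d) (R : realType)
    (nu : {measure set T -> \bar R}) (D : set T) (I : eqType) (s : seq I)
    (f : I -> T -> R) : measurable D ->
  (forall i, i \in s -> nu.-integrable D (EFin \o f i)) ->
  nu.-integrable D (EFin \o (fun x => \sum_(i <- s) f i x)).
Proof.
move=> mD; elim: s => [|i s IH] fi.
  rewrite (_ : _ \o _ = cst 0%E); first exact: integrable0.
  by apply/funext => x /=; rewrite big_nil.
rewrite (_ : _ \o _ = ((EFin \o f i) \+ (EFin \o (fun x => (\sum_(j <- s) f j x)%R)))%E).
  apply: integrableD => //; first by apply: fi; rewrite mem_head.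
  by apply: IH => j js; apply: fi; rewrite inE js orbT.
by apply/funext => x /=; rewrite big_cons.
Qed.

Lemma Rintegral_sum d (T : measurableType d) (R : realType)
    (nu : {measure set T -> \bar R}) (D : set T) (I : eqType) (s : seq I)
    (f : I -> T -> R) : measurable D ->
  (forall i, i \in s -> nu.-integrable D (EFin \o f i)) ->
  \int[nu]_(x in D) (\sum_(i <- s) f i x) = \sum_(i <- s) \int[nu]_(x in D) f i x.
Proof.
move=> mD; elim: s => [|i s IH] fi.
  rewrite big_nil (eq_Rintegral nu (g := fun=> 0)) ?Rintegral_cst ?mul0r//.
  by move=> x _; rewrite big_nil.
have fs j : j \in s -> nu.-integrable D (EFin \o f j).
  by move=> js; apply: fi; rewrite inE js orbT.
rewrite big_cons -IH// -RintegralD//; first last.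
- exact: integrable_sum_seq.
- by apply: fi; rewrite mem_head.
by apply: eq_Rintegral => x _; rewrite big_cons.
Qed.

Lemma L2dot_lincomb (R : realType) (a b : R) (I : eqType) (s : seq I)
    (c : I -> R) (g : I -> R -> R) (h : R -> R) :
  (forall i, i \in s -> inLp 2%:E a b (g i)) -> inLp 2%:E a b h ->
  inLp 2%:E a b (fun x => \sum_(i <- s) c i * g i x) /\
  L2dot a b (fun x => \sum_(i <- s) c i * g i x) h =
    \sum_(i <- s) c i * L2dot a b (g i) h.
Proof.
move=> gL hL; have cgL i : i \in s -> inLp 2%:E a b (fun x => c i * g i x).
  by move=> /gL; exact: inL2Z.
split; first exact: inL2_sum.
transitivity (\sum_(i <- s) L2dot a b (fun x => c i * g i x) h).
  rewrite -Rintegral_sum//.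
    by apply: eq_Rintegral => x _; rewrite mulr_suml.
  by move=> i /cgL giL; exact: inL2_mul_integrable.
by apply: eq_big_seq => i /gL giL; rewrite L2dotZl.
Qed.

(** * Testing a weak equation *)

Lemma test_function_derive1 (R : realType) (a b : R) (phi : R -> R) :
  test_function a b phi -> test_function a b (derive1 phi).
Proof.
move=> [dphi cK sub].
have S : closure [set x | derive1 phi x != 0] `<=` closure [set x | phi x != 0].
  have -> : closure [set x | phi x != 0] = closure (closure [set x | phi x != 0]).
    by apply/closure_id; exact: closed_closure.
  apply: closure_subset => x /=; apply: contra_neqP => nx.
  have : \forall y \near x, phi y = 0.
    have : \forall y \near x, (~` closure [set x | phi x != 0]) y.
      by apply: open_nbhs_nbhs; split => //; exact/closed_openC/closed_closure.
    apply: filterS => y ny; apply/eqP/negPn/negP => py; apply: ny.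
    exact: subset_closure.
  move=> H; rewrite derive1E (near_eq_derive (g := cst 0)) ?derive_cst//.
split.
- by move=> n x; have := dphi n.+1 x; rewrite derive1Sn.
- by apply: subclosed_compact cK S; exact: closed_closure.
- exact: subset_trans sub.
Qed.

Lemma test_function_continuous (R : realType) (a b : R) (phi : R -> R) :
  test_function a b phi -> continuous phi.
Proof.
move=> [dphi _ _] x; apply/differentiable_continuous/derivable1_diffP.
exact: (dphi 0%N).
Qed.

(** On the support of [phi], a compact subset of the open interval, [f] is integrable and [phi] is
    bounded; elsewhere the product vanishes. *)
Lemma locally_integrable_mul_test (R : realType) (a b : R) (f phi : R -> R) :
  locally_integrable `]a, b[ f -> test_function a b phi ->
  mu.-integrable `]a, b[ (EFin \o (fun x => f x * phi x)).
Proof.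
move=> [mf _ fK] tphi; have cphi := test_function_continuous _ _ _ _ tphi.
have [_ cK sub] := tphi; set K := closure _ in cK sub.
have mK : measurable K by exact: compact_measurable.
have mphi D : measurable_fun D phi.
  by apply: measurable_funTS; apply: continuous_measurable_fun; exact: cphi.
have iK : mu.-integrable K (EFin \o f).
  apply/integrableP; split; last exact: fK.
  by apply/measurable_EFinP; exact: measurable_funS sub mf.
have bphi : [bounded phi x | x in K].
  have : compact (phi @` K).
    by apply: continuous_compact => //; exact: continuous_subspaceT.
  move=> /compact_bounded[M [Mr HM]]; exists M; split => // y My x Kx.
  by apply: HM => //; exists x.
have iKphi : mu.-integrable K ((EFin \o phi) \* (EFin \o f))%E.
  by apply: integrableMr => //; exact: mphi.
have := (@integrable_mkcond _ (measurableTypeR R) R mu K _ mK).1 iKphi.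
move=> /(@integrableS _ (measurableTypeR R) R mu setT `]a, b[ _ measurableT
  (measurable_itv _) (@subsetT _ _)).
apply: eq_integrable => // x _; rewrite patchE; case: ifPn => [_|].
  by rewrite /= -EFinM mulrC.
rewrite notin_setE => nK /=; suff -> : phi x = 0 by rewrite mulr0.
by apply/eqP/negPn/negP => px; apply: nK; exact: subset_closure.
Qed.

(** Both sides equal the integral of [w] against the second derivative of [phi]: test the order 2
    relation with [phi] and the order 1 relation with [derive1 phi]. *)
Lemma weak_derivative2_test (R : realType) (a b : R) (w dw v phi : R -> R) :
  weak_derivative a b 1 w dw -> weak_derivative a b 2 w v ->
  test_function a b phi -> L2dot a b v phi = - L2dot a b dw (derive1 phi).
Proof.
move=> [_ _ H1] [_ _ H2] tphi.
have := H2 _ tphi; rewrite sqrrN expr1n mul1r /L2dot => <-.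
by rewrite -mulN1r -(H1 _ (test_function_derive1 _ _ _ _ tphi)).
Qed.

Lemma L2dot_cvgr (R : realType) (a b : R) (g w : R -> R) (phi : nat -> R -> R) :
  inLp 2%:E a b g -> inLp 2%:E a b w -> (forall m, inLp 2%:E a b (phi m)) ->
  (fun m => L2norm a b (phi m \- w)) @ \oo --> (0 : R) ->
  (fun m => L2dot a b g (phi m)) @ \oo --> L2dot a b g w.
Proof.
move=> gL wL phiL phiw.
have dL m : inLp 2%:E a b (phi m \- w).
  rewrite (_ : _ \- _ = phi m \+ (fun x => -1 * w x)).
    by apply: inL2D => //; exact: inL2Z.
  by apply/funext => x /=; rewrite mulN1r.
have E m : L2dot a b g (phi m) = L2dot a b g w + L2dot a b g (phi m \- w).
  rewrite ![L2dot a b g _]L2dotC -L2dotDl//; apply: eq_Rintegral => x _ /=.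
  by rewrite subrKC.
rewrite (funext E) -[X in _ --> X]addr0.
apply: cvgD; first exact: cvg_cst.
apply/norm_cvg0P; apply: (@squeeze_cvgr _ _ _ _ (cst 0)
  (fun m => L2norm a b g * L2norm a b (phi m \- w))).
- by apply: nearW => m; rewrite normr_ge0/= normr_L2dot_le.
- exact: cvg_cst.
- by rewrite -(mulr0 (L2norm a b g)); apply: cvgM => //; exact: cvg_cst.
Qed.

Lemma elliptic_test (R : realType) (a b : R) (s : seq nat) (om : nat -> R)
    (w dw v : nat -> R -> R) (z phi : R -> R) :
  inLp 2%:E a b z ->
  (forall j, j \in s -> weak_derivative a b 1 (w j) (dw j)) ->
  (forall j, j \in s -> weak_derivative a b 2 (w j) (v j)) ->
  {ae @lebesgue_measure R, forall x, x \in `]a, b[ ->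
    z x = \sum_(j <- s) om j * v j x} ->
  test_function a b phi ->
  L2dot a b z phi = - \sum_(j <- s) om j * L2dot a b (dw j) (derive1 phi).
Proof.
move=> zL H1 H2 zE tphi.
have iv j : j \in s -> mu.-integrable `]a, b[ (EFin \o (fun x => v j x * phi x)).
  by move=> /H2[_ lv _]; exact: locally_integrable_mul_test.
have ivZ j : j \in s ->
    mu.-integrable `]a, b[ (EFin \o (fun x => om j * (v j x * phi x))).
  by move=> /iv; apply: integrableZl_EFin.
rewrite -sumrN (eq_big_seq (fun j => \int[@lebesgue_measure R]_(x in `]a, b[)
    (om j * (v j x * phi x)))); last first.
  move=> j js; rewrite RintegralZl//; last exact: iv.
  by rewrite -mulrN -(weak_derivative2_test _ _ _ _ _ _ _ (H1 _ js) (H2 _ js) tphi).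
rewrite -Rintegral_sum//; congr fine; apply: ae_eq_integral => //.
- have phiL : inLp 2%:E a b phi.
    exact/continuous_inL2/(test_function_continuous _ _ _ _ tphi).
  exact: measurable_int (inL2_mul_integrable _ _ _ _ _ zL phiL).
- by apply: (measurable_int (@lebesgue_measure R)); apply: integrable_sum_seq.
- have [M [mM M0 sub]] := zE; exists M; split => //; apply: subset_trans sub => x /= nx zx.
  apply: nx => xD; rewrite zx ?inE//; congr EFin; rewrite mulr_suml.
  by apply: eq_bigr => j _; rewrite mulrA.
Qed.

(* Only the combination z of the v j is square integrable by hypothesis, so no
   uniqueness of weak derivatives is needed. *)
Lemma elliptic_energy (R : realType) (a b : R) (s : seq nat) (om : nat -> R)
    (w dw v : nat -> R -> R) (z w0 dw0 : R -> R) (phi : nat -> R -> R) :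
  inLp 2%:E a b z -> (forall j, j \in s -> inLp 2%:E a b (dw j)) ->
  (forall j, j \in s -> weak_derivative a b 1 (w j) (dw j)) ->
  (forall j, j \in s -> weak_derivative a b 2 (w j) (v j)) ->
  {ae @lebesgue_measure R, forall x, x \in `]a, b[ ->
    z x = \sum_(j <- s) om j * v j x} ->
  inLp 2%:E a b w0 -> inLp 2%:E a b dw0 ->
  (forall m, test_function a b (phi m)) ->
  (fun m => L2norm a b (phi m \- w0)) @ \oo --> (0 : R) ->
  (fun m => L2norm a b (derive1 (phi m) \- dw0)) @ \oo --> (0 : R) ->
  L2dot a b z w0 = - \sum_(j <- s) om j * L2dot a b (dw j) dw0.
Proof.
move=> zL dwL H1 H2 zE w0L dw0L tphi cphi cdphi.
have tL m : inLp 2%:E a b (phi m).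
  exact/continuous_inL2/(test_function_continuous _ _ _ _ (tphi m)).
have tdL m : inLp 2%:E a b (derive1 (phi m)).
  apply/continuous_inL2/(test_function_continuous _ a b).
  exact: test_function_derive1.
have c1 := L2dot_cvgr _ _ _ _ _ _ zL w0L tL cphi.
have c2 : (fun m => - \sum_(j <- s) om j * L2dot a b (dw j) (derive1 (phi m))) @ \oo -->
    - \sum_(j <- s) om j * L2dot a b (dw j) dw0.
  apply: cvgN; rewrite big_seq (_ : (fun m => _) = (fun m =>
      \sum_(j <- s | j \in s) om j * L2dot a b (dw j) (derive1 (phi m)))); last first.
    by apply/funext => m; rewrite big_seq.
  apply: cvg_big => [|j js]; first exact: add_continuous.
  apply: cvgM; first exact: cvg_cst.
  exact: L2dot_cvgr (dwL _ js) dw0L tdL cdphi.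
have E : (fun m => L2dot a b z (phi m)) =
    (fun m => - \sum_(j <- s) om j * L2dot a b (dw j) (derive1 (phi m))).
  by apply/funext => m; exact: (elliptic_test _ _ _ _ _ _ _ _ _ _ zL H1 H2 zE (tphi m)).
by rewrite E in c1; exact: (cvg_unique _ c1 c2).
Qed.

(** * Energy estimate *)

(** The positivity for real sequences is applied to the values [v n x] at each point [x] and then
    integrated. *)
Lemma sum_weight_L2dot_ge0 (R : realType) (a b al tau : R) (N : nat) (v : nat -> R -> R) :
  0 < al < 1 -> 0 < tau -> (forall n, (n <= N)%N -> inLp 2%:E a b (v n)) ->
  0 <= \sum_(1 <= n < N.+1) \sum_(1 <= j < n.+1)
         weight tau (beta_kernel al) n j * L2dot a b (v j) (v n).
Proof.
move=> al01 tau0 vL.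
pose g n x := (\sum_(1 <= j < n.+1) weight tau (beta_kernel al) n j * v j x) : R.
have gL n : (n <= N)%N -> inLp 2%:E a b (g n) /\ L2dot a b (g n) (v n) =
    \sum_(1 <= j < n.+1) weight tau (beta_kernel al) n j * L2dot a b (v j) (v n).
  move=> nN; apply: L2dot_lincomb; last exact: vL.
  move=> j; rewrite mem_index_iota => /andP[_ jn]; apply: vL.
  by rewrite (leq_trans _ nN).
rewrite (eq_big_nat _ _ (F2 := fun n => L2dot a b (g n) (v n))); last first.
  by move=> n /andP[_ nN]; rewrite (gL n nN).2.
rewrite -Rintegral_sum//.
  by apply: Rintegral_ge0 => x _; exact: sum_weight_beta_ge0.
move=> n; rewrite mem_index_iota => /andP[_ nN].
by apply: inL2_mul_integrable; [exact: (gL n nN).1|exact: vL].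
Qed.

Lemma L2dot_young (R : realType) (a b e : R) (g h : R -> R) :
  inLp 2%:E a b g -> inLp 2%:E a b h -> 0 < e ->
  `|L2dot a b g h| <= e * L2dot a b g g + (4 * e)^-1 * L2dot a b h h.
Proof.
move=> gL hL e0; apply: le_trans (normr_L2dot_le _ _ _ _ _ gL hL) _.
rewrite -!L2norm_sqr//; set x := L2norm a b g; set y := L2norm a b h.
rewrite -subr_ge0 (_ : _ - _ = e * (x - (2 * e)^-1 * y) ^+ 2).
  by rewrite mulr_ge0 ?sqr_ge0// ltW.
by field; rewrite gt_eqF.
Qed.

Lemma scheme_energy (R : realType) (sigma r a b al tau : R) (dq : R -> R) (N : nat)
    (F : R -> R -> R) (W : nat -> R -> R) :
  0 < al < 1 -> 0 < tau ->
  bs_scheme sigma r a b al dq tau N F W ->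
  (forall n, (1 <= n <= N)%N -> inLp 2%:E a b (F ^~ (n%:R * tau))) ->
  (forall n, (n <= N)%N -> inLp 2%:E a b (W n)) /\
  forall m, (m <= N)%N ->
    \sum_(1 <= n < m.+1) L2dot a b (W n) (W n) <=
    \sum_(1 <= n < m.+1) (L2dot a b (F ^~ (n%:R * tau)) (W n)
      - \sum_(1 <= j < n.+1) weight tau dq n j * L2dot a b (W j) (W n)).
Proof.
move=> al01 tau0 [WH _ [d2W [d2WP WE]]] FL.
(* The gradients are those supplied by [H10]: square integrable, and limits of derivatives of test
   functions. *)
have [dW dWP] : exists dW : nat -> R -> R, forall n, (n <= N)%N ->
    [/\ inLp 2%:E a b (W n), inLp 2%:E a b (dW n), weak_derivative a b 1 (W n) (dW n) &
      exists phi : nat -> R -> R,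
      [/\ forall m : nat, test_function a b (phi m),
          (fun m => L2norm a b (phi m \- W n)) @ \oo --> (0 : R) &
          (fun m => L2norm a b (derive1 (phi m) \- dW n)) @ \oo --> (0 : R)]].
  have /choice[dW H] : forall n, exists dw, (n <= N)%N ->
    [/\ inLp 2%:E a b (W n), inLp 2%:E a b dw, weak_derivative a b 1 (W n) dw &
      exists phi : nat -> R -> R,
      [/\ forall m : nat, test_function a b (phi m),
          (fun m => L2norm a b (phi m \- W n)) @ \oo --> (0 : R) &
          (fun m => L2norm a b (derive1 (phi m) \- dw)) @ \oo --> (0 : R)]].
    move=> n; have [nN|nN] := boolP (n <= N)%N; last by exists (cst 0).
    by have [_ [dw H]] := WH n nN; exists dw.
  by exists dW.
have WL n : (n <= N)%N -> inLp 2%:E a b (W n) by move=> /dWP[].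
have dWL n : (n <= N)%N -> inLp 2%:E a b (dW n) by move=> /dWP[].
split=> // m mN.
have [wb wbE] : exists g, g = weight tau (beta_kernel al) by exists (weight tau (beta_kernel al)).
have [wq wqE] : exists g, g = weight tau dq by exists (weight tau dq).
rewrite -wqE; rewrite -wqE -wbE in WE.
have jN n j : (n <= N)%N -> j \in index_iota 1 n.+1 -> (j <= N)%N.
  by rewrite mem_index_iota => nN /andP[_ jn]; rewrite (leq_trans _ nN).
have WsL n (om : nat -> R) : (n <= N)%N ->
    inLp 2%:E a b (fun x => \sum_(1 <= j < n.+1) om j * W j x) /\
    L2dot a b (fun x => \sum_(1 <= j < n.+1) om j * W j x) (W n) =
    \sum_(1 <= j < n.+1) om j * L2dot a b (W j) (W n).
  move=> nN; apply: L2dot_lincomb; last exact: WL.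
  by move=> j /(jN n j nN); exact: WL.
have energy n : (1 <= n <= N)%N ->
    L2dot a b (W n) (W n) = L2dot a b (F ^~ (n%:R * tau)) (W n)
      - \sum_(1 <= j < n.+1) wq n j * L2dot a b (W j) (W n)
      - bs_lambda sigma r * \sum_(1 <= j < n.+1) wb n j * L2dot a b (W j) (W n)
      - 2^-1 * sigma ^+ 2 * \sum_(1 <= j < n.+1) wb n j * L2dot a b (dW j) (dW n).
  move=> n1N; have /andP[n1 nN] := n1N.
  have [q1 q2] := WsL n (wq n) nN.
  have [b1 b2] := WsL n (wb n) nN.
  (* Everything in the equation except the elliptic sum. It is a combination of the [W j] and of the
     source, hence square integrable, and it equals the elliptic sum almost everywhere. *)
  pose z := W n \+ ((fun x => \sum_(1 <= j < n.+1) wq n j * W j x) \+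
    ((fun x => bs_lambda sigma r * \sum_(1 <= j < n.+1) wb n j * W j x) \+
     (fun x => -1 * F x (n%:R * tau)))).
  have fL := FL n n1N; have wL := WL n nN.
  have b3 := inL2Z _ _ _ (bs_lambda sigma r) _ b1.
  have f3 := inL2Z _ _ _ (-1) _ fL.
  have bf := inL2D _ _ _ _ _ b3 f3.
  have qbf := inL2D _ _ _ _ _ q1 bf.
  have zL : inLp 2%:E a b z by exact: inL2D.
  have [_ dwL wd [phi [tphi c1 c2]]] := dWP n nN.
  have sumZ (g : nat -> R) : \sum_(1 <= j < n.+1) 2^-1 * sigma ^+ 2 * wb n j * g j =
      2^-1 * sigma ^+ 2 * \sum_(1 <= j < n.+1) wb n j * g j.
    by rewrite mulr_sumr; apply: eq_bigr => j _; ring.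
  have : L2dot a b z (W n) = - \sum_(1 <= j < n.+1)
      (2^-1 * sigma ^+ 2 * wb n j) * L2dot a b (dW j) (dW n).
    apply: (elliptic_energy _ _ _ _ _ W _ d2W _ _ _ phi) => //.
    - by move=> j /(jN n j nN); exact: dWL.
    - by move=> j /(jN n j nN) /dWP[].
    - by move=> j /(jN n j nN); exact: d2WP.
    have [M [mM M0 sub]] := WE n n1N; exists M; split => //.
    apply: subset_trans sub => x /= nx WEx; apply: nx => /WEx zx.
    rewrite /z/= -zx sumZ.
    ring.
  rewrite /z (L2dotDl _ _ _ _ _ _ wL qbf wL) (L2dotDl _ _ _ _ _ _ q1 bf wL).
  rewrite (L2dotDl _ _ _ _ _ _ b3 f3 wL) (L2dotZl _ _ _ _ _ _ b1 wL).
  rewrite (L2dotZl _ _ _ _ _ _ fL wL) q2 b2 sumZ.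
  move: (L2dot a b) => dot.
  lra.
have -> : \sum_(1 <= n < m.+1) L2dot a b (W n) (W n) =
    \sum_(1 <= n < m.+1) (L2dot a b (F ^~ (n%:R * tau)) (W n)
      - \sum_(1 <= j < n.+1) wq n j * L2dot a b (W j) (W n))
    - bs_lambda sigma r * \sum_(1 <= n < m.+1) \sum_(1 <= j < n.+1) wb n j * L2dot a b (W j) (W n)
    - 2^-1 * sigma ^+ 2 *
      \sum_(1 <= n < m.+1) \sum_(1 <= j < n.+1) wb n j * L2dot a b (dW j) (dW n).
  rewrite !mulr_sumr -!sumrB; apply: eq_big_nat => n /andP[n1 nm].
  by rewrite energy// n1 (leq_trans _ mN).
rewrite -addrA gerDl -opprD oppr_le0 addr_ge0// mulr_ge0//.
- by rewrite mulr_ge0 ?sqr_ge0.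
- rewrite wbE; apply: sum_weight_L2dot_ge0 => // n nm; apply: WL; exact: leq_trans mN.
- by rewrite mulr_ge0 ?sqr_ge0.
- rewrite wbE; apply: sum_weight_L2dot_ge0 => // n nm; apply: dWL; exact: leq_trans mN.
Qed.

Lemma L2dot_ge0 (R : realType) (a b : R) (g : R -> R) : 0 <= L2dot a b g g.
Proof. by apply: Rintegral_ge0 => x _; rewrite -expr2 sqr_ge0. Qed.

Lemma ler_sum_nat_widen (R : realType) (u : nat -> R) (m N : nat) :
  (forall n, 0 <= u n) -> (m <= N)%N ->
  \sum_(1 <= n < m.+1) u n <= \sum_(1 <= n < N.+1) u n.
Proof.
move=> u0 mN; rewrite (@big_cat_nat _ _ _ m.+1 1 N.+1)//=.
by rewrite lerDl sumr_ge0.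
Qed.

(** Stated for scalars: [w], [f] stand for squared norms and [dot], [fdot] for inner products. The
    energy inequality is summed in time, so Gronwall is applied to the partial sums [S] of [w]. *)
Lemma scheme_stability (R : realType) (T Cq tau : R) (N : nat) (w f : nat -> R)
    (dot : nat -> nat -> R) (fdot : nat -> R) (om : nat -> nat -> R) :
  0 <= Cq -> 0 < tau -> N%:R * tau = T -> (0 < N)%N ->
  4 * Cq * (Cq * T + 1) * tau <= 1 ->
  (forall n, 0 <= w n) -> (forall n, 0 <= f n) ->
  (forall n, (1 <= n <= N)%N -> `|fdot n| <= f n + 4^-1 * w n) ->
  (forall e n j, 0 < e -> (1 <= n <= N)%N -> (1 <= j <= n)%N ->
     `|dot j n| <= (4 * e)^-1 * w j + e * w n) ->
  (forall n j, (1 <= n <= N)%N -> (1 <= j <= n)%N -> `|om n j| <= Cq * tau) ->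
  (forall m, (m <= N)%N -> \sum_(1 <= n < m.+1) w n <=
    \sum_(1 <= n < m.+1) (fdot n - \sum_(1 <= j < n.+1) om n j * dot j n)) ->
  \sum_(1 <= n < N.+1) w n <=
    2 * expR (4 * Cq * (Cq * T + 1) * T) * \sum_(1 <= n < N.+1) f n.
Proof.
move=> Cq0 tau0 NT N0 tau1 w0 f0 fdotE dotE omE H.
have T0 : 0 <= T by rewrite -NT mulr_ge0// ltW.
(* A memory row has [n] weights of size at most Cq tau with n tau <= T, so the Young parameter e =
   1/(4K) leaves at most w n / 4 at the current level. The 1 keeps [K] positive when [Cq] is 0. *)
pose K := Cq * T + 1; have K0 : 0 < K by rewrite ltr_wpDl// mulr_ge0.
pose e := (4 * K)^-1; have e0 : 0 < e by rewrite invr_gt0 mulr_gt0.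
have eK : (4 * e)^-1 = K by rewrite /e; field; rewrite gt_eqF.
pose S m := \sum_(1 <= n < m.+1) w n.
pose Phi := \sum_(1 <= n < N.+1) f n.
have Phi0 : 0 <= Phi by rewrite sumr_ge0.
have S0 m : 0 <= S m by rewrite sumr_ge0.
have memory n : (1 <= n <= N)%N ->
    - (\sum_(1 <= j < n.+1) om n j * dot j n) <= Cq * tau * K * S n + 4^-1 * w n.
  move=> nN; apply: le_trans (ler_norm _) _; rewrite normrN.
  apply: le_trans (ler_norm_sum _ _ _) _.
  apply: (@le_trans _ _ (\sum_(1 <= j < n.+1) Cq * tau * (K * w j + e * w n))).
    rewrite !big_nat; apply: ler_sum => j jn; rewrite normrM ler_pM//.
      exact: omE.
    by rewrite -eK; exact: dotE.
  rewrite -mulr_sumr big_split/= -mulr_sumr sumr_const_nat subSS subn0.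
  rewrite mulrDr mulrA lerD2l -mulr_natr.
  have ntT : n%:R * tau <= T.
    by rewrite -NT ler_pM2r// ler_nat; case/andP: nN.
  have CT : Cq * (n%:R * tau) <= K by rewrite ler_wpDr// ler_wpM2l.
  rewrite (_ : _ * _ = Cq * (n%:R * tau) * e * w n); last by ring.
  rewrite ler_wpM2r// /e ler_pdivrMr ?mulr_gt0//; lra.
(* A quarter of [w n] from the source and a quarter from the memory: half of [S m] moves to the
   left, which doubles the other terms. The Gronwall constant 2 Cq K tau is at most 1/2 precisely by
   the smallness of [tau]. *)
have main m : (1 <= m <= N)%N ->
    S m <= 2 * Phi + 2 * Cq * K * tau * \sum_(1 <= n < m.+1) S n.
  move=> /andP[m1 mN].
  have : S m <= \sum_(1 <= n < m.+1) (f n + (2^-1 * w n + Cq * tau * K * S n)).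
    apply: le_trans (H m mN) _; rewrite !big_nat; apply: ler_sum => n /andP[n1 nm].
    have nN : (1 <= n <= N)%N by rewrite n1 (leq_trans _ mN).
    have := fdotE n nN; have := ler_norm (fdot n); have := memory n nN; lra.
  rewrite !big_split/= -!mulr_sumr -/(S m).
  have := ler_sum_nat_widen _ f m N f0 mN; rewrite -/Phi; lra.
have k01 : 0 <= 2 * Cq * K * tau <= 2^-1.
  apply/andP; split; first by rewrite !mulr_ge0// ltW.
  by move: tau1; rewrite -/K; lra.
have Phi2 : 0 <= 2 * Phi by rewrite mulr_ge0.
have := discrete_gronwall R S (2 * Phi) (2 * Cq * K * tau) N Phi2 k01 S0 main N0.
have -> : 2 * (2 * Cq * K * tau) * N%:R = 4 * Cq * K * T by rewrite -NT; ring.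
by rewrite mulrAC.
Qed.

(** The back transformation turns [cstar] into [c], and (p + c)^2 <= 2 p^2 + 2 c^2. The constant is
    chosen before the data, as the final bound must be uniform in them. *)
Lemma L2norm_bs_approx (R : realType) (sigma r a b : R) :
  exists2 M, 0 <= M & forall (c : R -> R) (W : nat -> R -> R) (n : nat),
    inLp 2%:E a b c -> inLp 2%:E a b (W n) ->
    L2norm a b (bs_approx sigma r c W n) ^+ 2 <=
    M * L2dot a b (W n) (W n) + 2 * L2norm a b c ^+ 2.
Proof.
pose k := bs_shift sigma r.
pose B := expR (`|k| * (`|a| + `|b|)).
exists (2 * B ^+ 2); first by rewrite mulr_ge0 ?sqr_ge0.
move=> c W n cL WL.
have kB x : a < x < b -> `|expR (k * x)| <= B.
  move=> /andP[ax xb]; rewrite ger0_norm ?expR_ge0// ler_expR.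
  apply: le_trans (ler_norm _) _; rewrite normrM ler_wpM2l//.
  have := ler_norm a; have := ler_norm (- a); have := ler_norm b; have := ler_norm (- b).
  by rewrite !normrN ler_norml => h1 h2 h3 h4; apply/andP; split; lra.
have mk : measurable_fun `]a, b[ (fun x : R => expR (k * x)).
  apply: measurable_funTS; apply: continuous_measurable_fun => x.
  by apply: continuous_comp; [apply: cvgM; [exact: cvg_cst|exact: cvg_id]|exact: continuous_expR].
have eWL := inL2M_bounded _ _ _ _ _ _ mk kB WL.
have UE : bs_approx sigma r c W n = ((fun x => expR (k * x)) \* W n) \+ c.
  apply/funext => x; rewrite /bs_approx /cstar/= -/k mulrDr; congr (_ + _).
  by rewrite mulrA -expRD subrr expR0 mul1r.
rewrite UE !L2norm_sqr//; last exact: inL2D.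
have i1 := inL2_mul_integrable _ _ _ _ _ WL WL.
have i2 := inL2_mul_integrable _ _ _ _ _ cL cL.
rewrite /L2dot -!RintegralZl// -RintegralD//; last 2 first.
- by apply: integrableZl_EFin.
- by apply: integrableZl_EFin.
apply: le_Rintegral => //.
- by apply: inL2_mul_integrable; exact: inL2D.
- by apply: (@integrableD _ (measurableTypeR R) R mu _ (measurable_itv _)
     (fun x => (2 * B ^+ 2 * (W n x * W n x))%:E) (fun x => (2 * (c x * c x))%:E));
    exact: integrableZl_EFin.
move=> x /=; rewrite in_itv/= => xab.
have : (expR (k * x)) ^+ 2 <= B ^+ 2.
  by rewrite ler_sqr ?nnegrE ?expR_ge0// (le_trans (ler_norm _)) ?kB.
move=> /(ler_wpM2r (sqr_ge0 (W n x))); set y := expR _ => yB.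
have := sqr_ge0 (y * W n x - c x); rewrite !expr2 in yB *; lra.
Qed.

Theorem theorem3p1 (R : realType) (T sigma r a b alphastar Cq : R)
    (alpha dq : R -> R) :
  0 < T -> 0 < sigma -> 0 <= r -> a < b ->
  sobolev 1 +oo%E 0 T alpha ->
  {within `[0, T], continuous alpha} ->
  (forall t : R, 0 <= t <= T -> 0 < alpha t <= alphastar) ->
  alphastar < 1 ->
  has_derivative_within `[0, T] alpha 0 0 ->
  (forall t : R, 0 <= t <= T ->
     has_derivative_within `[0, T] (q_kernel alpha) t (dq t)) ->
  (forall t : R, 0 <= t <= T ->
     `|q_kernel alpha t| <= Cq /\ `|dq t| <= Cq) ->
  exists C : R, 0 < C /\ exists tau0 : R, 0 < tau0 /\
    forall (N : nat) (c d2c : R -> R) (f u : R -> R -> R) (W : nat -> R -> R),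
      let tau := T / N%:R in
      let F := bs_F sigma r (alpha 0) c d2c f in
      let U := bs_approx sigma r c W in
      (0 < N)%N -> tau <= tau0 ->
      inLp 2%:E a b c ->
      weak_derivative a b 2 (cstar sigma r c) d2c ->
      (forall n : nat, (1 <= n <= N)%N ->
         inLp 2%:E a b (fun x => F x (n%:R * tau))) ->
      bs_solution T sigma r a b alpha f c u ->
      bs_scheme sigma r a b (alpha 0) dq tau N F W ->
      normA a b tau N U <=
        C * (L2norm a b c +
             Num.sqrt (tau * \sum_(1 <= n < N.+1)
                               L2norm a b (fun x => F x (n%:R * tau)) ^+ 2)).
Proof.
move=> T0 sigma0 r0 ab _ _ alP al1 _ _ qP.
have [|al0 ala] := andP (alP 0 _); first by rewrite lexx ltW.
have al01 : 0 < alpha 0 < 1 by rewrite al0 (le_lt_trans ala).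
have Cq0 : 0 <= Cq.
  by have [_] := qP 0 (introT andP (conj (lexx _) (ltW T0))); apply: le_trans.
have [M M0 UM] := L2norm_bs_approx R sigma r a b.
pose K := 4 * Cq * (Cq * T + 1); have K0 : 0 <= K by rewrite !mulr_ge0// addr_ge0 ?mulr_ge0// ltW.
(* [A] is the factor of the source and 2T that of the datum in the bound for the squared norm. The
   added 1 makes the final constant at least 1, hence at most its own square, when the root is
   taken. *)
pose A := M * (2 * expR (K * T)).
have A0 : 0 <= A by rewrite !mulr_ge0 ?expR_ge0.
exists (1 + A + 2 * T); split; first by rewrite ltr_wpDr ?mulr_ge0 ?(ltW T0)// ltr_wpDr.
(* Inverting K + 1 rather than [K], which may be 0, still gives K tau <= 1. *)
exists (K + 1)^-1; split; first by rewrite invr_gt0 ltr_wpDl.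
move=> N c d2c f u W tau F U N0 tau1 cL _ FL _ WS.
have Npos : 0 < N%:R :> R by rewrite ltr0n.
have tau0 : 0 < tau by rewrite divr_gt0.
have NT : N%:R * tau = T by rewrite /tau mulrC divfK// gt_eqF.
have [WL energy] := scheme_energy _ _ _ _ _ _ _ _ _ _ _ al01 tau0 WS FL.
have Ktau : K * tau <= 1.
  have : (K + 1) * tau <= 1 by rewrite mulrC -ler_pdivlMr ?ltr_wpDl// mul1r.
  by rewrite mulrDl mul1r; lra.
pose w n := L2dot a b (W n) (W n).
pose fn n := L2dot a b (F ^~ (n%:R * tau)) (F ^~ (n%:R * tau)).
have stab : \sum_(1 <= n < N.+1) w n <= 2 * expR (K * T) * \sum_(1 <= n < N.+1) fn n.
  apply: (scheme_stability R T Cq tau N w fn (fun j n => L2dot a b (W j) (W n))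
    (fun n => L2dot a b (F ^~ (n%:R * tau)) (W n)) (weight tau dq)) => //.
  - by move=> n; exact: L2dot_ge0.
  - by move=> n; exact: L2dot_ge0.
  - move=> n nN; have := L2dot_young _ _ _ 1 _ _ (FL n nN) (WL n _) ltr01.
    by rewrite mulr1 mul1r; apply; case/andP: nN.
  - move=> e n j e0 /andP[_ nN] /andP[_ jn]; rewrite L2dotC addrC.
    by apply: L2dot_young => //; apply: WL => //; exact: leq_trans nN.
  - move=> n j /andP[n1 nN] jn; apply: (weight_bound _ T) => //.
      by move=> x /qP[].
    by rewrite -NT ler_pM2r// ler_nat.
set Phi := \sum_(1 <= n < N.+1) L2norm a b (fun x => F x (n%:R * tau)) ^+ 2.
have PhiE : Phi = \sum_(1 <= n < N.+1) fn n.
  by apply: eq_big_nat => n nN; rewrite L2norm_sqr//; exact: FL.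
have Phi0 : 0 <= tau * Phi.
  by rewrite mulr_ge0 ?(ltW tau0)//; apply: sumr_ge0 => n _; rewrite sqr_ge0.
set s := Num.sqrt (tau * Phi); have s0 : 0 <= s by exact: sqrtr_ge0.
have s2 : s ^+ 2 = tau * Phi by rewrite sqr_sqrtr.
set nc := L2norm a b c; have nc0 : 0 <= nc by exact: L2norm_ge0.
have UE : tau * \sum_(1 <= l < N.+1) L2norm a b (U l) ^+ 2 <= A * s ^+ 2 + 2 * T * nc ^+ 2.
  have : \sum_(1 <= l < N.+1) L2norm a b (U l) ^+ 2 <=
      \sum_(1 <= l < N.+1) (M * w l + 2 * nc ^+ 2).
    rewrite !big_nat; apply: ler_sum => l /andP[_ lN].
    by apply: UM => //; exact: WL.
  rewrite big_split/= -mulr_sumr sumr_const_nat subSS subn0 -[_ *+ N]mulr_natl => HU.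
  have := ler_wpM2l M0 stab; rewrite -PhiE => HM.
  have {HU HM}HU := ler_wpM2l (ltW tau0) (le_trans HU (lerD HM (lexx _))).
  apply: le_trans HU _; rewrite s2 /A -[X in 2 * X * nc ^+ 2]NT; lra.
have C0 : 0 <= (1 + A + 2 * T) * (nc + s).
  by rewrite mulr_ge0 ?addr_ge0// mulr_ge0// ltW.
rewrite /normA -/Phi -/s -/nc -[leRHS]ger0_norm// -sqrtr_sqr ler_sqrt ?sqr_ge0//.
apply: le_trans UE _; rewrite exprMn.
have cs : nc ^+ 2 + s ^+ 2 <= (nc + s) ^+ 2.
  by rewrite sqrrD addrAC lerDl mulrn_wge0// mulr_ge0.
apply: (@le_trans _ _ ((1 + A + 2 * T) * (nc ^+ 2 + s ^+ 2))).
  have := mulr_ge0 A0 (sqr_ge0 nc); have := mulr_ge0 (ltW T0) (sqr_ge0 s).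
  have := sqr_ge0 nc; have := sqr_ge0 s; lra.
apply: ler_pM => //; rewrite ?addr_ge0 ?sqr_ge0// ?mulr_ge0// ?(ltW T0)//.
rewrite expr2 ler_peMr// ?addr_ge0// ?mulr_ge0// ?(ltW T0)//.
have : 0 <= 2 * T by rewrite mulr_ge0// ltW.
lra.
Qed.
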